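(* For each $L\in H$, the renewal system $\mathsf{X}(L)$ has cyclic Bowen-Franks group and determinant $$1-\gamma+\sum_{j=1}^m\left(\gamma_{j,r_j}t_j-b_j\right),$$ where, if $L$ is constructed from $W_1,\ldots,W_m\in B$ (with $W_j$ having parameters $r_j\ge2$, $c_{j,1},\ldots,c_{j,r_j}$, $d_j$) and the additional finite set of words $\tilde W$, one puts $a=|\tilde W|$, $\alpha_j=\tilde\alpha_j=c_{j,1}$, $\beta_j=d_j$, $\gamma_{j,k}=c_{j,k}$ for $2\le k\le r_j$, and $$\gamma=a+\sum_{j=1}^m\Big(\alpha_j+\tilde\alpha_j+\sum_{k=2}^{r_j-1}\gamma_{j,k}\Big),\quad b_j=\alpha_j\beta_j\gamma_{j,2}\cdots\gamma_{j,r_j},\quad t_j=\tilde\alpha_j\gamma_{j,2}\cdots\gamma_{j,r_j-1}(b_j-\beta_j)-1 .$$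
   Context: Renewal systems: for a finite list $L$ of words over a finite alphabet, $\mathsf{X}(L)$ is the shift space whose language is the set of factors of finite concatenations of words from $L$. Bowen-Franks group and determinant: every shift of finite type (SFT) is conjugate to the edge shift $\mathsf{X}_A$ of a finite directed graph with adjacency matrix $A$ (an $n\times n$ matrix of non-negative integers). The Bowen-Franks group of the SFT is $\mathbb{Z}^n/\mathbb{Z}^n(\mathrm{Id}-A)$ and its determinant is $\det(\mathrm{Id}-A)$; these do not depend on the choice of $A$ (they are invariants of conjugacy, and of flow equivalence). The class $H$ defined below is introduced as a class of lists generating SFT renewal systems. The class $B$: let $r\ge2$ and $n_1,\ldots,n_r,c_1,\ldots,c_r,d,N\in\mathbb{N}$. A list in $B$ with these parameters is the set $W$ of the following words, where $\alpha_{i,s}$, $\tilde\alpha_{i,s}$, $\gamma_{k,i,s}$, $\beta_l$ denote distinct letters: - $\alpha_i=\alpha_{i,1}\cdots\alpha_{i,n_1}$ for $1\le i\le c_1$; - $\tilde\alpha_i=\tilde\alpha_{i,1}\cdots\tilde\alpha_{i,n_1}$ for $1\le i\le c_1$; - $\gamma_{k,i_k}=\gamma_{k,i_k,1}\cdots\gamma_{k,i_k,n_k}$ for $2\le k\le r$, $1\le i_k\le c_k$; - $\alpha_{i_1}\gamma_{2,i_2}\cdots\gamma_{r,i_r}\beta_l^N$ for $1\le i_j\le c_j$, $1\le l\le d$; - $\beta_l^N\tilde\alpha_{i_1}\gamma_{2,i_2}\cdots\gamma_{r,i_r}$ for $1\le i_j\le c_j$, $1\le l\le d$. The class $\tilde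 H$: take $W_1,\ldots,W_m\in B$ with disjoint alphabets, $W=\bigcup_{j=1}^mW_j$, and a finite set $\tilde W$ of words that do not share any letters with each other or with the words from $W$; $\tilde H$ is the set of all lists $W\cup\tilde W$ constructed in this manner. The class $H$: given $\tilde L\in\tilde H$ and $p\in\mathbb{N}$, introduce for each letter $x$ of the alphabet of $\mathsf{X}(\tilde L)$ new letters $x_1,\ldots,x_p$ and replace every occurrence of $x$ in $\tilde L$ by the word $x_1\cdots x_p$; $H$ is the set of all lists obtained this way. In the formula, $\alpha_j,\tilde\alpha_j,\beta_j,\gamma_{j,k}$ denote the integers specified in the claim (not letters), and empty products are $1$ and empty sums are $0$.
   Formalization: Added: no (nonempty) word of the additional set W~ is a proper power u^k, k≥2, unless L is a single word. Otherwise X(L) is not an SFT (W~={aa,c} gives the even shift) and its Bowen-Franks group is undefined. *)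

(* Defs.v *)
From HB Require Import structures.
From mathcomp Require Import all_boot all_order all_algebra.
From mathcomp Require Import ring_quotient.
From mathcomp Require Import boolp.

Set Implicit Arguments.
Unset Strict Implicit.
Unset Printing Implicit Defensive.

Import GRing.Theory.

Local Open Scope ring_scope.

(** * Shift spaces

    A set of bi-infinite sequences over [T] is a predicate on [int -> T]. *)

Definition word_at (T : Type) (x : int -> T) (i : int) (l : nat) : seq T :=
  mkseq (fun k => x (i + k%:Z)) l.

(** A shift space is determined by its language: it consists of the sequences
    all of whose blocks lie in the language. *)
Definition renewal_system (T : eqType) (L : seq (seq T)) (x : int -> T) : Prop :=
  forall (i : int) (l : nat), exists s : seq (seq T),
    {subset s <= L} /\ infix (word_at x i l) (flatten s).

(** [A i j] edges run from vertex [i] to vertex [j]. *)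
Definition edge (n : nat) (A : 'M[nat]_n) : finType :=
  {ij : 'I_n * 'I_n & 'I_(A ij.1 ij.2)}.

Definition edge_shift (n : nat) (A : 'M[nat]_n) (x : int -> edge A) : Prop :=
  forall i : int, (tag (x i)).2 = (tag (x (i + 1))).1.

Arguments edge_shift {n} A x.

(** Block maps are partial since only the words in the language of [X] are
    to be mapped to letters (the alphabet [T'] may be empty). *)
Definition sliding_block_code (T T' : Type)
    (X : (int -> T) -> Prop) (Y : (int -> T') -> Prop)
    (phi : {x | X x} -> {y | Y y}) : Prop :=
  exists (mem ant : nat) (Phi : seq T -> option T'), forall x (i : int),
    Phi (word_at (sval x) (i - mem%:Z) (mem + ant).+1) = Some (sval (phi x) i).

Definition conjugate (T T' : Type)
    (X : (int -> T) -> Prop) (Y : (int -> T') -> Prop) : Prop :=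
  exists (phi : {x | X x} -> {y | Y y}) (psi : {y | Y y} -> {x | X x}),
    [/\ sliding_block_code phi, sliding_block_code psi,
        forall x, sval (psi (phi x)) =1 sval x
      & forall y, sval (phi (psi y)) =1 sval y].

(** * Bowen-Franks group and determinant

    The Bowen-Franks group and determinant of a shift of finite type [X] are
    those of any matrix [A] such that [X] is conjugate to [edge_shift A]. *)

Definition id_minus (n : nat) (A : 'M[nat]_n) : 'M[int]_n :=
  1%:M - map_mx Posz A.

Definition bf_lattice (n : nat) (A : 'M[nat]_n) : {pred 'rV[int]_n} :=
  fun v => `[< exists w : 'rV[int]_n, v = w *m id_minus A >].

Fact bf_lattice_zmod_closed (n : nat) (A : 'M[nat]_n) :
  zmod_closed (bf_lattice A).
Proof.
split; first by apply/asboolP; exists 0; rewrite mul0mx.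
move=> u v /asboolP[w ->] /asboolP[w' ->]; apply/asboolP.
by exists (w - w'); rewrite mulmxBl.
Qed.

HB.instance Definition _ (n : nat) (A : 'M[nat]_n) :=
  GRing.isZmodClosed.Build 'rV[int]_n (bf_lattice A)
    (bf_lattice_zmod_closed A).

Definition bowen_franks_group (n : nat) (A : 'M[nat]_n) : zmodType :=
  Quotient.quot (bf_lattice A).

Definition bowen_franks_det (n : nat) (A : 'M[nat]_n) : int :=
  \det (id_minus A).

Definition cyclic_zmod (G : zmodType) : Prop :=
  exists g : G, forall h : G, exists k : int, h = g *~ k.

(** * The class B

    Only the values of [B_n] and [B_c] at [1, ..., B_r] matter. *)

Record B_parameters := BParameters {
  B_r : nat;
  B_n : nat -> nat;
  B_c : nat -> nat;
  B_d : nat;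
  B_N : nat
}.

Definition B_admissible (P : B_parameters) : Prop :=
  [/\ (2 <= B_r P)%N,
      forall k, (1 <= k <= B_r P)%N -> (0 < B_n P k)%N /\ (0 < B_c P k)%N,
      (0 < B_d P)%N
    & (0 < B_N P)%N].

Inductive B_letter :=
  | Alpha of nat & nat
  | Alphat of nat & nat
  | Gamma of nat & nat & nat
  | Beta of nat.

Definition B_valid (P : B_parameters) : pred B_letter := fun x =>
  match x with
  | Alpha i s | Alphat i s => (1 <= i <= B_c P 1)%N && (1 <= s <= B_n P 1)%N
  | Gamma k i s =>
      [&& (2 <= k <= B_r P)%N, (1 <= i <= B_c P k)%N & (1 <= s <= B_n P k)%N]
  | Beta l => (1 <= l <= B_d P)%N
  end.

Section BWords.

Variables (T : eqType) (P : B_parameters) (lt : B_letter -> T).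

Definition alpha_word (i : nat) : seq T :=
  [seq lt (Alpha i s) | s <- iota 1 (B_n P 1)].

Definition alphat_word (i : nat) : seq T :=
  [seq lt (Alphat i s) | s <- iota 1 (B_n P 1)].

Definition gamma_word (k i : nat) : seq T :=
  [seq lt (Gamma k i s) | s <- iota 1 (B_n P k)].

Definition gamma_words (i : nat -> nat) : seq T :=
  flatten [seq gamma_word k (i k) | k <- iota 2 (B_r P).-1].

Definition beta_word (l : nat) : seq T := nseq (B_N P) (lt (Beta l)).

Definition choice_of_indices (i : nat -> nat) : Prop :=
  forall k, (1 <= k <= B_r P)%N -> (1 <= i k <= B_c P k)%N.

Inductive B_word : seq T -> Prop :=
  | BAlpha i : (1 <= i <= B_c P 1)%N -> B_word (alpha_word i)
  | BAlphat i : (1 <= i <= B_c P 1)%N -> B_word (alphat_word i)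
  | BGamma k i : (2 <= k <= B_r P)%N -> (1 <= i <= B_c P k)%N ->
      B_word (gamma_word k i)
  | BAlphaBeta i l : choice_of_indices i -> (1 <= l <= B_d P)%N ->
      B_word (alpha_word (i 1) ++ gamma_words i ++ beta_word l)
  | BBetaAlphat i l : choice_of_indices i -> (1 <= l <= B_d P)%N ->
      B_word (beta_word l ++ alphat_word (i 1) ++ gamma_words i).

End BWords.

Definition in_B (T : eqType) (P : B_parameters) (W : seq (seq T)) : Prop :=
  B_admissible P /\
  exists lt : B_letter -> T,
    {in B_valid P &, injective lt} /\
    (forall w, w \in W <-> B_word P lt w).

(** * The classes H~ and H *)

Definition share_letter (T : eqType) (u v : seq T) : bool := has (mem u) v.

Definition in_Ht (T : eqType) (m : nat) (P : 'I_m -> B_parameters)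
    (Wt Lt : seq (seq T)) : Prop :=
  exists W : 'I_m -> seq (seq T),
    [/\ forall j, in_B (P j) (W j),
        forall j j', j != j' ->
          {in W j & W j', forall u v, ~~ share_letter u v},
        uniq Wt && ([::] \notin Wt),
        {in Wt &, forall u v, u != v -> ~~ share_letter u v} /\
        (forall j, {in W j & Wt, forall u v, ~~ share_letter u v})
      & forall w, w \in Lt <-> (exists j, w \in W j) \/ w \in Wt].

(** The new letters replacing [x] are [e x 1, ..., e x p]. *)
Definition letter_expansion (T S : eqType) (p : nat)
    (Lt : seq (seq T)) (L : seq (seq S)) : Prop :=
  exists e : T -> nat -> S,
    (forall x y s t, x \in flatten Lt -> y \in flatten Lt ->
       (1 <= s <= p)%N -> (1 <= t <= p)%N -> e x s = e y t ->
       x = y /\ s = t) /\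
    L =i [seq flatten [seq [seq e x s | s <- iota 1 p] | x <- w] | w <- Lt].

(** [L] belongs to [H] and is constructed from lists in [B] with parameters
    [P j] and from the set of words [Wt]. *)
Definition in_H (T : eqType) (m : nat) (P : 'I_m -> B_parameters)
    (Wt : seq (seq T)) (S : eqType) (L : seq (seq S)) : Prop :=
  exists (Lt : seq (seq T)) (p : nat),
    [/\ in_Ht P Wt Lt, (0 < p)%N & letter_expansion p Lt L].

Definition proper_power (T : eqType) (w : seq T) : Prop :=
  exists (u : seq T) (k : nat), (2 <= k)%N /\ w = flatten (nseq k u).

(** A word of [Wt] may repeat letters.  If it is a proper power and [L] has
    another word, then the renewal system is not of finite type, so it has no
    Bowen-Franks group: the words [aa] and [c] generate the even shift. *)
Definition extra_words_primitive (T S : eqType) (Wt : seq (seq T))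
    (L : seq (seq S)) : Prop :=
  (exists w, L =i [:: w]) \/ {in Wt, forall w, ~ proper_power w}.

(** * The formula *)

Definition B_alpha (P : B_parameters) : int := (B_c P 1)%:Z.
Definition B_alphat (P : B_parameters) : int := (B_c P 1)%:Z.
Definition B_beta (P : B_parameters) : int := (B_d P)%:Z.
Definition B_gamma (P : B_parameters) (k : nat) : int := (B_c P k)%:Z.

Definition B_b (P : B_parameters) : int :=
  B_alpha P * B_beta P * \prod_(2 <= k < (B_r P).+1) B_gamma P k.

Definition B_t (P : B_parameters) : int :=
  B_alphat P * (\prod_(2 <= k < B_r P) B_gamma P k) * (B_b P - B_beta P) - 1.

Definition H_gamma (m : nat) (P : 'I_m -> B_parameters) (a : nat) : int :=
  a%:Z + \sum_(j < m) (B_alpha (P j) + B_alphat (P j)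
                       + \sum_(2 <= k < B_r (P j)) B_gamma (P j) k).

(* Main.v *)
(* Reading concatenations of words of [L] from left to right, one only has to
   remember, for each list [W_j], how much of a product [alpha gamma_2 .. gamma_r]
   has just been read, since this decides whether a following [beta^N] is free or
   must be continued by some [alphat gamma_2 .. gamma_r].  This gives a partial
   deterministic automaton whose labelled paths are the factors of concatenations.
   Two distinct states are never the endpoints of cycles with the same label, so by
   the pigeonhole principle a long enough past determines the state, and labelling
   is a conjugacy from the edge shift of the automaton to [X(L)].

   In the Bowen-Franks group every state is a multiple of the initial state: after
   subtracting the row of the initial state from those of the states recording
   [alpha gamma_2 .. gamma_k], the matrix [Id - A] is unitriangular away from the
   initial state.  This proves cyclicity, and the determinant is the entry left in
   the initial state after elimination. *)

From mathcomp Require Import all_boot all_order all_algebra.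
From mathcomp Require Import perm.
From HB Require Import structures.
From mathcomp Require Import generic_quotient ring_quotient boolp.
From mathcomp Require Import zify ring.
Require Import Defs.

Set Implicit Arguments.
Unset Strict Implicit.
Unset Printing Implicit Defensive.

Import GRing.Theory.
Local Open Scope ring_scope.

(** * Determinants and row lattices of rooted matrices *)

(** Two obstacles shape the construction. A state recording a chain [alpha gamma_2 .. gamma_k] reads
    every block that the initial state reads, with the same effect except for blocks prolonging the
    chain and, when [k = r], for the [beta_l] of its list. In particular every [alpha] of the list
    leads from it to the chain of length one, so there are cycles avoiding the initial state and
    [Id - A] is not triangular away from it. Subtracting the root row cancels exactly the common
    transitions and leaves an acyclic rest. The second obstacle is that [beta_l^N] is a proper power
    for [N >= 2], so a position inside it cannot be seen from its letters. Hence the units that are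
    read are primitive blocks with disjoint alphabets, [beta_l] alone being one of them, and the
    number of [beta_l] read is kept in the state. Primitivity and disjointness recover the block
    boundaries from the letters; what remains is a statement about an automaton reading blocks. The
    expansion by [p] only lengthens blocks, and states inside a block have a single outgoing edge,
    so [p] does not enter the determinant. *)

Lemma det_ranked (R : comPzRingType) (n : nat) (X : 'M[R]_n) (rk : 'I_n -> nat) :
  (forall i j, i != j -> (rk i <= rk j)%N -> X i j = 0) ->
  \det X = \prod_i X i i.
Proof.
move=> X0; rewrite /determinant (bigD1 (1%g : 'S_n)) //= [X in _ + X]big1 ?addr0.
  by rewrite odd_perm1 mul1r; apply: eq_bigr => i _; rewrite perm1.
move=> s s1.
case: (pickP (fun i => (s i != i) && (rk i <= rk (s i)))%N) => [i /andP[si le]|none].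
  by rewrite (bigD1 i) //= (X0 i (s i)) ?mul0r ?mulr0 // eq_sym.
have lt_rk i : s i != i -> (rk (s i) < rk i)%N.
  by move=> si; move: (none i); rewrite si /= ltnNge => ->.
have [i si]: exists i, s i != i.
  apply/existsP; apply: contraR s1 => /existsPn fix_s; apply/eqP/permP => i.
  by rewrite perm1; apply/eqP/negbNE/fix_s.
(* A surviving term of the Leibniz sum lowers the rank of every index it moves, whereas a
   permutation preserves the total rank. *)
suff: (\sum_j rk (s j) < \sum_j rk j)%N.
  by rewrite [X in (_ < X)%N](reindex_inj (@perm_inj _ s)) ltnn.
rewrite (bigD1 i) //= [X in (_ < X)%N](bigD1 i) //= -addSn leq_add ?lt_rk //.
apply: leq_sum => j _; case: (eqVneq (s j) j) => [->//|sj].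
by rewrite ltnW ?lt_rk.
Qed.

Section RootedMatrix.

Variables (n : nat) (M : 'M[int]_n) (o : 'I_n) (rk : 'I_n -> nat).
Variables (d c : 'I_n -> int).
Hypothesis d_root : d o = 0.
Hypothesis c_root : c o = 1.

Let M' (i j : 'I_n) : int := M i j - d i * M o j.

Hypothesis M'_diag : forall i, i != o -> M' i i = 1.
Hypothesis M'_rank : forall i j, i != o -> j != o -> i != j ->
  (rk i <= rk j)%N -> M' i j = 0.
Hypothesis M'_c : forall i, i != o -> \sum_j M' i j * c j = 0.

(* Row operations turn [M] into [M'] and a column operation replaces column
   [o] by [M' c]; what remains is triangular for the order given by [rk]. *)
Lemma det_rooted : \det M = \sum_j M o j * c j.
Proof.
pose E : 'M[int]_n := \matrix_(i, j) ((i == j)%:R - d i * (j == o)%:R).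
pose U : 'M[int]_n := \matrix_(i, j) (if j == o then c i else (i == j)%:R).
have M'o j : M' o j = M o j by rewrite /M' d_root mul0r subr0.
have detE : \det E = 1.
  rewrite (@det_ranked _ _ _ (fun i => (i != o) : nat)).
    rewrite big1 // => i _; rewrite !mxE eqxx.
    by case: eqP => [->|_]; rewrite ?d_root ?mul0r ?mulr0 subr0.
  move=> i j nij; rewrite !mxE (negbTE nij).
  case: (eqVneq j o) => [_|_]; last by rewrite mulr0 subr0.
  by case: eqP => [->|//]; rewrite d_root mul0r subr0.
have detU : \det U = 1.
  rewrite (@det_ranked _ _ _ (fun i => (i != o) : nat)).
    by rewrite big1 // => i _; rewrite !mxE eqxx; case: eqP => [->|].
  move=> i j nij; rewrite !mxE (negbTE nij).
  by case: (eqVneq j o) nij => [-> nio|//]; rewrite nio.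
have EM i j : (E *m M) i j = M' i j.
  rewrite mxE (bigD1 i) //= !mxE eqxx /M'.
  under eq_bigr => k nki do rewrite mxE eq_sym (negbTE nki) sub0r.
  case: (eqVneq i o) => [->|nio].
    rewrite d_root !mul0r !subr0 mul1r big1 ?addr0 // => k _.
    by rewrite mul0r oppr0 mul0r.
  rewrite mulr0 subr0 mul1r; congr (_ + _).
  rewrite (bigD1 o) 1?eq_sym //= eqxx mulr1 big1 ?addr0 ?mulNr // => k /andP[_ nko].
  by rewrite (negbTE nko) mulr0 oppr0 mul0r.
have EMU i j : (E *m M *m U) i j = if j == o then \sum_k M' i k * c k else M' i j.
  rewrite mxE; case: ifP => jo.
    by apply: eq_bigr => k _; rewrite EM !mxE jo.
  rewrite (bigD1 j) //= EM !mxE jo eqxx mulr1 big1 ?addr0 // => k nkj.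
  by rewrite !mxE jo (negbTE nkj) mulr0.
have <- : \det (E *m M *m U) = \det M by rewrite !det_mulmx detE detU mul1r mulr1.
(* The root gets the top rank: its row may then be arbitrary, and its column vanishes off the
   diagonal by [M'_c]. *)
rewrite (@det_ranked _ _ _ (fun i => if i == o then (\max_k rk k).+1 else rk i)).
  rewrite (bigD1 o) //= EMU eqxx [X in _ * X]big1 ?mulr1.
    by apply: eq_bigr => k _; rewrite M'o.
  by move=> i nio; rewrite EMU (negbTE nio) M'_diag.
move=> i j nij; rewrite EMU.
case: (eqVneq i o) nij => [->|nio] nij.
  by rewrite eq_sym (negbTE nij) leqNgt ltnS leq_bigmax.
case: (eqVneq j o) => [_ _|njo]; first exact: M'_c.
exact: M'_rank.
Qed.

(** Row [i] of [M'] lies in the row lattice of [M], and it is [delta_mx 0 i] plus a multiple of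
    [delta_mx 0 o] plus multiples of unit vectors of smaller rank; induction on the rank
    concludes. *)
Lemma rows_multiple_of_root (i : 'I_n) : exists (k : int) (w : 'rV[int]_n),
  delta_mx 0 i = k *: delta_mx 0 o + w *m M.
Proof.
have [r] := ubnP (rk i); elim: r => // r IHr in i *; rewrite ltnS => le_r.
case: (eqVneq i o) => [->|nio].
  by exists 1, 0; rewrite scale1r mul0mx addr0.
have /fin_all_exists[k /fin_all_exists[w kw]] : forall j, exists (k : int) (w : 'rV[int]_n),
    j != i -> M' i j *: delta_mx 0 j = k *: delta_mx 0 o + w *m M :> 'rV[int]_n.
  move=> j; case: (eqVneq j i) => [_|nji]; first by exists 0, 0.
  case: (eqVneq j o) => [->|njo].
    by exists (M' i o), 0 => _; rewrite mul0mx addr0.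
  case: (leqP (rk i) (rk j)) => [le_ij|lt_ji].
    exists 0, 0 => _; rewrite M'_rank // 1?eq_sym //.
    by rewrite !scale0r mul0mx addr0.
  have [k [w ->]] := IHr j (leq_trans lt_ji le_r).
  exists (M' i j * k), (M' i j *: w) => _.
  by rewrite scalerDr scalerA scalemxAl.
exists (- \sum_(j | j != i) k j),
  ((delta_mx 0 i - d i *: delta_mx 0 o) - \sum_(j | j != i) w j).
have rowM' : (delta_mx 0 i - d i *: delta_mx 0 o) *m M
             = delta_mx 0 i + \sum_(j | j != i) M' i j *: delta_mx 0 j :> 'rV_n.
  transitivity (\sum_j M' i j *: delta_mx 0 j : 'rV[int]_n); last first.
    by rewrite (bigD1 i) //= M'_diag // scale1r.
  apply/rowP => j; rewrite mulmxBl -scalemxAl -!rowE !mxE summxE (bigD1 j) //=.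
  rewrite !mxE !eqxx mulr1 big1 ?addr0 // => k' nk'.
  by rewrite !mxE eqxx eq_sym (negbTE nk') mulr0.
rewrite mulmxBl rowM' mulmx_suml.
rewrite scaleNr scaler_suml [X in delta_mx 0 i + X](eq_bigr _ (fun j nji => kw j nji)).
by rewrite big_split /= -!addrA subrr addr0 addrCA addNr addr0.
Qed.

End RootedMatrix.

(** * Deterministic automata and edge shifts *)

Section Run.

Variables (S V : Type) (delta : V -> S -> option V).

Fixpoint run (x : V) (u : seq S) : option V :=
  if u is a :: u' then obind (fun y => run y u') (delta x a) else Some x.

Lemma run_cat x u v : run x (u ++ v) = obind (fun y => run y v) (run x u).
Proof. by elim: u x => //= a u IHu x; case: (delta x a). Qed.

Lemma run_rcons x u a : run x (rcons u a) = obind (fun y => delta y a) (run x u).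
Proof. by rewrite -cats1 run_cat; case: (run x u) => //= y; case: (delta y a). Qed.

Lemma run_catl x u v : run x (u ++ v) -> exists2 y, run x u = Some y & run y v.
Proof. by rewrite run_cat; case: (run x u) => // y; exists y. Qed.

Lemma run_cycle x u n : run x u = Some x -> run x (flatten (nseq n u)) = Some x.
Proof. by move=> xu; elim: n => //= n IHn; rewrite run_cat xu. Qed.

End Run.

Section Automaton.

Variables (S V : finType) (delta : V -> S -> option V).

Local Notation run := (run delta).

Definition dfa_mx : 'M[nat]_#|V| :=
  \matrix_(i, j) #|[set a | delta (enum_val i) a == Some (enum_val j)]|.

Local Notation edge := (edge dfa_mx).

Definition edge_source (e : edge) : V := enum_val (tag e).1.
Definition edge_target (e : edge) : V := enum_val (tag e).2.

Lemma dfa_mxE (ij : 'I_#|V| * 'I_#|V|) : dfa_mx ij.1 ij.2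
  = #|[set a | delta (enum_val ij.1) a == Some (enum_val ij.2)]|.
Proof. by rewrite mxE. Qed.

(** An edge is only a number below a matrix entry; it is read as a position in the enumeration of
    the letters leading from its source to its target. *)
Definition edge_label (e : edge) : S :=
  enum_val (cast_ord (dfa_mxE (tag e)) (tagged e)).

Lemma edge_delta e : delta (edge_source e) (edge_label e) = Some (edge_target e).
Proof.
by have := enum_valP (cast_ord (dfa_mxE (tag e)) (tagged e)); rewrite inE => /eqP.
Qed.

Lemma edge_exists x a y : delta x a = Some y ->
  exists e, [/\ edge_source e = x, edge_label e = a & edge_target e = y].
Proof.
move=> xay; pose ij := (enum_rank x, enum_rank y).
have a_in : a \in [set a | delta (enum_val ij.1) a == Some (enum_val ij.2)].
  by rewrite inE /= !enum_rankK xay.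
exists (existT (fun ij : 'I_#|V| * 'I_#|V| => 'I_(dfa_mx ij.1 ij.2)) ij
  (cast_ord (esym (dfa_mxE ij)) (enum_rank_in a_in a))).
split; [exact: enum_rankK | | exact: enum_rankK].
by rewrite /edge_label /= cast_ordKV enum_rankK_in.
Qed.

Lemma edge_inj e e' :
  edge_source e = edge_source e' -> edge_label e = edge_label e' -> e = e'.
Proof.
move=> src lab; have tgt : edge_target e = edge_target e'.
  by apply: Some_inj; rewrite -!edge_delta src lab.
case: e e' src lab tgt => [[i j] k] [[i' j'] k'] /enum_val_inj /= ii' lab /enum_val_inj /= jj'.
case: _ / ii' jj' k' lab => jj'; case: _ / jj' => k' /enum_val_inj /cast_ord_inj kk'.
by congr existT.
Qed.

Lemma edge_shift_target (y : int -> edge) i : edge_shift dfa_mx y ->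
  edge_target (y i) = edge_source (y (i + 1)).
Proof. by move=> /(_ i) e; rewrite /edge_target e. Qed.

Lemma run_edges (y : int -> edge) i l : edge_shift dfa_mx y ->
  run (edge_source (y i)) (word_at (fun k => edge_label (y k)) i l)
  = Some (edge_source (y (i + l%:Z))).
Proof.
move=> yP; elim: l => [|l IHl]; first by rewrite addr0.
rewrite /word_at mkseqS run_rcons -/(word_at _ _ _) IHl /= edge_delta.
by rewrite edge_shift_target // -addrA -PoszD addn1.
Qed.

Hypothesis cycle_unique : forall x y u, u != [::] ->
  run x u = Some x -> run y u = Some y -> x = y.

(* By the pigeonhole principle two runs over the same long word pass twice
   through the same pair of states. *)
Lemma run_merge x y u x' y' : (#|{: V * V}| <= size u)%N ->
  run x u = Some x' -> run y u = Some y' -> x' = y'.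
Proof.
move=> le_u xu yu.
have stP z z' : run z u = Some z' -> exists st : nat -> V, forall i, run z (take i u) = Some (st i).
  move=> zu; suff /choice[st stP] : forall i, exists t, run z (take i u) = Some t by exists st.
  move=> i; move: zu; rewrite -{1}(cat_take_drop i u) run_cat.
  by case: (run z (take i u)) => // t _; exists t.
have [sx sxP] := stP _ _ xu; have [sy syP] := stP _ _ yu.
pose f (i : 'I_(size u).+1) := (sx i, sy i).
have /injectivePn[i [j nij]] : ~~ injectiveb f.
  apply/negP => /injectiveP /leq_card; rewrite card_ord.
  by rewrite leqNgt ltnS le_u.
wlog lt_ij : i j nij / (i < j)%N.
  move=> W; case: (ltngtP i j) => [|lt_ji eqf|/val_inj eq_ij]; first exact: W.
    by apply: (W j i) => //; rewrite eq_sym.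
  by rewrite eq_ij eqxx in nij.
case=> eqx eqy; pose v := take (j - i) (drop i u).
have tj : take j u = take i u ++ v by rewrite -takeD subnKC // ltnW.
have vn0 : v != [::].
  rewrite -size_eq0 size_takel ?subn_eq0 -?ltnNge //.
  by rewrite size_drop leq_sub2r // -ltnS ltn_ord.
have cyc z (st : nat -> V) : (forall i, run z (take i u) = Some (st i)) ->
    st i = st j -> run (st i) v = Some (st i).
  by move=> st_run eq_st; have := st_run j; rewrite tj run_cat st_run /= eq_st.
have eq_i := cycle_unique vn0 (cyc _ _ sxP eqx) (cyc _ _ syP eqy).
move: xu yu; rewrite -{1 2}(cat_take_drop i u) !run_cat sxP syP /= eq_i => ->.
by move=> [].
Qed.

(** * Recovering the path from a bounded past *)

Variable L : seq (seq S).

Hypothesis run_flatten : forall s, {subset s <= L} -> exists x, run x (flatten s).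
(** The prefix [u] absorbs the start of the run, which may lie inside a block that no past
    justifies; only what follows has to be a factor. *)
Hypothesis infix_flatten : exists k, forall x u v, (k <= size u)%N ->
  run x (u ++ v) -> exists s, {subset s <= L} /\ infix v (flatten s).

Let K := #|{: V * V}|.

(** Local rule of the inverse map: by [run_merge] the first [K] letters of [w] fix the source of
    [e], whatever state [x] the reading starts from. *)
Definition reads_to (w : seq S) (e : edge) : bool :=
  [exists x, (run x (take K w) == Some (edge_source e))
             && (drop K w == [:: edge_label e])].

Lemma reads_to_inj w e e' : reads_to w e -> reads_to w e' -> e = e'.
Proof.
move=> /existsP[x /andP[/eqP xw /eqP we]] /existsP[y /andP[/eqP yw /eqP we']].
apply: edge_inj; last by move: we'; rewrite we => -[].
apply: run_merge xw yw; rewrite size_takel //.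
by have := congr1 size we; rewrite size_drop /=; move: (size w) => s; lia.
Qed.

Lemma word_atD (T : Type) (x : int -> T) i k l :
  word_at x i (k + l) = word_at x i k ++ word_at x (i + k%:Z) l.
Proof.
rewrite /word_at /mkseq iotaD map_cat add0n; congr (_ ++ _).
rewrite -[X in iota X]addn0 iotaDl -map_comp.
by apply: eq_map => j /=; rewrite PoszD addrA.
Qed.

Lemma word_at1 (T : Type) (x : int -> T) i : word_at x i 1 = [:: x i].
Proof. by rewrite /word_at /mkseq /= addr0. Qed.

Lemma size_word_at (T : Type) (x : int -> T) i l : size (word_at x i l) = l.
Proof. exact: size_mkseq. Qed.

Lemma renewal_run (x : int -> S) i l : renewal_system L x ->
  exists z, run z (word_at x i l).
Proof.
move=> /(_ i l) [s [sL /infixP[u [v uv]]]].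
have [z] := run_flatten sL; rewrite uv => zu.
have [y _ yw] := run_catl zu; have [t yt _] := run_catl yw.
by exists y; rewrite yt.
Qed.

Lemma renewal_edge (x : int -> S) : renewal_system L x ->
  forall i, exists e, reads_to (word_at x (i - K%:Z) K.+1) e.
Proof.
move=> xL i; have [z] := renewal_run (i - K%:Z) K.+1 xL.
rewrite -addn1 word_atD word_at1 => zw; have [y zy /=] := run_catl zw.
case ya : (delta _ _) => [t|] // _.
have [e [ey ea et]] := edge_exists ya.
exists e; apply/existsP; exists z.
rewrite take_size_cat ?drop_size_cat ?size_word_at // zy ey eqxx.
by rewrite ea eqxx.
Qed.

Definition renewal_lift (x : {x | renewal_system L x}) (i : int) : edge :=
  xchoose (renewal_edge (svalP x) i).

Lemma renewal_liftP x i :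
  reads_to (word_at (sval x) (i - K%:Z) K.+1) (renewal_lift x i).
Proof. exact: xchooseP (renewal_edge (svalP x) i). Qed.

Lemma renewal_lift_label x i : edge_label (renewal_lift x i) = sval x i.
Proof.
have /existsP[z /andP[_ /eqP]] := renewal_liftP x i.
rewrite -addn1 word_atD drop_size_cat ?size_word_at //.
by rewrite word_at1 subrK => -[].
Qed.

(** The two edges come from overlapping windows. A single run over the [K.+2] letters covering both
    exhibits two consecutive edges, which [reads_to_inj] identifies with the chosen ones. *)
Lemma renewal_lift_shift x : edge_shift dfa_mx (renewal_lift x).
Proof.
move=> i; suff: edge_target (renewal_lift x i) = edge_source (renewal_lift x (i + 1)).
  by move/enum_val_inj.
have [z] := renewal_run (i - K%:Z) K.+2 (svalP x).
set w := word_at _ _ _; set e := renewal_lift x i; set e' := renewal_lift x (i + 1).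
have wE : w = word_at (sval x) (i - K%:Z) K ++ [:: sval x i; sval x (i + 1)].
  rewrite /w -addn2 word_atD; congr (_ ++ _).
  by rewrite subrK (word_atD _ _ 1 1) !word_at1.
have wE' : w = sval x (i - K%:Z) :: word_at (sval x) (i + 1 - K%:Z) K ++ [:: sval x (i + 1)].
  rewrite /w -[K.+2]add1n word_atD word_at1 -[K.+1]addn1 word_atD; congr (_ :: _ ++ _).
    by rewrite addrAC.
  by rewrite word_at1 addrAC subrK.
move=> zw; have := zw; rewrite wE => zw'; have [y zy /=] := run_catl zw'.
case ya : (delta y _) => [t|] //=.
case tb : (delta t _) => [t'|] // _.
have [f [fy fa ft]] := edge_exists ya.
have [f' [f't f'b _]] := edge_exists tb.
have <- : f = e.
  apply: reads_to_inj (renewal_liftP x i); apply/existsP; exists z.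
  rewrite -addn1 word_atD take_size_cat ?drop_size_cat ?size_word_at //.
  by rewrite zy fy eqxx fa word_at1 subrK /=.
have <- : f' = e'.
  apply: reads_to_inj (renewal_liftP x (i + 1)); apply/existsP.
  move: zw; rewrite wE' /=; case z1 : (delta z _) => [z'|] //= zw.
  exists z'; rewrite -addn1 word_atD take_size_cat ?drop_size_cat ?size_word_at //.
  rewrite f'b word_at1 subrK eqxx andbT f't.
  have : run z (word_at (sval x) (i - K%:Z) K ++ [:: sval x i]) = Some t.
    by rewrite run_cat zy /= ya.
  have -> : word_at (sval x) (i - K%:Z) K ++ [:: sval x i]
      = sval x (i - K%:Z) :: word_at (sval x) (i + 1 - K%:Z) K.
    move: wE; rewrite wE' -cat_cons -[[:: _; _]]cat1s catA.
    by rewrite !cats1 => /rcons_inj [].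
  by rewrite /= z1 /= => ->.
by rewrite ft f't.
Qed.

(** A bi-infinite path allows every window to be extended by [k] letters to the left, as
    [infix_flatten] requires. *)
Lemma edge_shift_renewal (y : {y | edge_shift dfa_mx y}) :
  renewal_system L (fun i => edge_label (sval y i)).
Proof.
move=> i l; have [k kP] := infix_flatten; pose x i := edge_label (sval y i).
apply: (kP (edge_source (sval y (i - k%:Z))) (word_at x (i - k%:Z) k)).
  by rewrite size_word_at.
have -> : word_at x (i - k%:Z) k ++ word_at x i l = word_at x (i - k%:Z) (k + l).
  by rewrite word_atD subrK.
by rewrite (run_edges _ _ (svalP y)).
Qed.

Lemma dfa_conjugate : conjugate (renewal_system L) (edge_shift dfa_mx).
Proof.
exists (fun x => exist (edge_shift dfa_mx) _ (renewal_lift_shift x)).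
exists (fun y => exist (renewal_system L) _ (edge_shift_renewal y)); split => /=.
- exists K, 0%N, (fun w => [pick e | reads_to w e]) => x i /=.
  rewrite addn0; case: pickP => [e e_in|/(_ (renewal_lift x i))].
    by congr Some; apply: reads_to_inj e_in (renewal_liftP x i).
  by rewrite renewal_liftP.
- exists 0%N, 0%N, (fun w => omap edge_label (ohead w)) => y i /=.
  by rewrite subr0 addr0.
- by move=> x i /=; rewrite renewal_lift_label.
move=> y i; set x := exist _ _ _.
apply: reads_to_inj (renewal_liftP x i) _.
apply/existsP; exists (edge_source (sval y (i - K%:Z))).
rewrite -addn1 word_atD take_size_cat ?drop_size_cat ?size_word_at //.
by rewrite /= (run_edges _ _ (svalP y)) subrK word_at1 !eqxx.
Qed.

End Automaton.

(** * Bowen-Franks invariants of an automaton *)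

Lemma bowen_franks_cyclic (n : nat) (A : 'M[nat]_n) (o : 'I_n) :
  (forall i, exists (k : int) (w : 'rV[int]_n),
     delta_mx 0 i = k *: delta_mx 0 o + w *m id_minus A) ->
  cyclic_zmod (bowen_franks_group A).
Proof.
move=> /fin_all_exists[k /fin_all_exists[w kw]].
pose p : 'rV[int]_n -> bowen_franks_group A := \pi%qT.
exists (p (delta_mx 0 o)) => h; rewrite -[h]reprK; set v := repr h.
exists (\sum_i v 0 i * k i); rewrite /p -raddfMz.
apply/eqP; rewrite -Quotient.idealrBE; apply/asboolP.
exists (\sum_i v 0 i *: w i).
rewrite -scaler_int intz {1}[v]row_sum_delta mulmx_suml.
under eq_bigr => i _ do rewrite kw scalerDr scalerA.
rewrite big_split /= -scaler_suml addrAC subrr add0r.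
by apply: eq_bigr => i _; rewrite scalemxAl.
Qed.

Section AutomatonDeterminant.

Variables (S V : finType) (delta : V -> S -> option V).
(* The row of [root] is subtracted from the rows of the states in [d]; in the
   Bowen-Franks group the state [x] is then [c x] times [root]. *)
Variables (root : V) (rk : V -> nat) (d : pred V) (c : V -> int).

Local Notation val_at x a := (oapp c 0 (delta x a)).

Hypothesis d_root : ~~ d root.
Hypothesis c_root : c root = 1.
(** Once the root row is subtracted, what survives are the transitions of [x] not shared with the
    root and, with opposite sign, those of the root not shared with [x]; both have to lower the
    rank. [c_step] says that the reduced rows annihilate [c]. *)
Hypothesis rk_step : forall x a y, x != root -> delta x a = Some y ->
  ~~ (d x && (delta root a == Some y)) -> (rk y < rk x)%N.
Hypothesis rk_root_step : forall x a y, x != root -> d x ->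
  delta root a = Some y -> delta x a != Some y -> (rk y < rk x)%N.
Hypothesis c_step : forall x, x != root ->
  c x = \sum_a val_at x a + (if d x then 1 - \sum_a val_at root a else 0).

Let M := id_minus (dfa_mx delta).
Let x_ (i : 'I_#|V|) : V := enum_val i.

Lemma dfa_id_minusE i j :
  M i j = (i == j)%:R - \sum_a (delta (x_ i) a == Some (x_ j))%:R.
Proof.
rewrite !mxE; congr (_ - _).
rewrite -sum1_card (big_morph Posz PoszD (erefl _)) big_mkcond.
by apply: eq_bigr => a _; rewrite inE; case: eqP.
Qed.

Lemma dfa_id_minus_c i :
  \sum_j M i j * c (x_ j) = c (x_ i) - \sum_a val_at (x_ i) a.
Proof.
under eq_bigr => j _ do rewrite dfa_id_minusE mulrBl.
rewrite sumrB; congr (_ - _).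
  rewrite (bigD1 i) //= eqxx mul1r big1 ?addr0 // => j nj.
  by rewrite eq_sym (negbTE nj) mul0r.
under eq_bigr => j _ do rewrite mulr_suml.
rewrite exchange_big; apply: eq_bigr => a _ /=.
case: (delta _ a) => [y|] /=; last by rewrite big1 // => j _; rewrite mul0r.
rewrite (bigD1 (enum_rank y)) //= /x_ enum_rankK eqxx mul1r big1 ?addr0 // => j nj.
rewrite (_ : (Some y == _) = false) ?mul0r //; apply/eqP => -[yj].
by rewrite yj enum_valK eqxx in nj.
Qed.

Lemma dfa_det_cyclic :
  bowen_franks_det (dfa_mx delta) = 1 - \sum_a val_at root a
  /\ cyclic_zmod (bowen_franks_group (dfa_mx delta)).
Proof.
pose o := enum_rank root; pose di i : int := (d (x_ i))%:R.
pose M' i j := M i j - di i * M o j.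
have xo : x_ o = root by rewrite /x_ enum_rankK.
have nroot i : i != o -> x_ i != root.
  by apply: contraNneq => e; rewrite -(enum_valK i) -/(x_ i) e.
have di_o : di o = 0 by rewrite /di xo (negbTE d_root).
have c_o : c (x_ o) = 1 by rewrite xo.
have M'E i j : i != o -> j != o -> (rk (x_ i) <= rk (x_ j))%N ->
    M' i j = (i == j)%:R.
  move=> nio njo le_ij; rewrite /M' !dfa_id_minusE eq_sym [o == j]eq_sym (negbTE njo).
  rewrite sub0r mulrN opprK -addrA [- _ + _]addrC mulr_sumr -sumrB big1 ?addr0 1?eq_sym // => a _.
  rewrite xo /di.
  case: (eqVneq (delta (x_ i) a) (Some (x_ j))) => [ij|nij].
    have := rk_step (nroot i nio) ij; rewrite ltnNge le_ij /=.
    by case: (d _); case: eqP => //= _ /(_ isT).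
  case: (boolP (d (x_ i))) => di_i; last by rewrite mul0r subr0.
  case: eqP => [oj|_]; last by rewrite mulr0 subr0.
  by have := rk_root_step (nroot i nio) di_i oj nij; rewrite ltnNge le_ij.
have M'_diag i : i != o -> M' i i = 1 by move=> nio; rewrite M'E ?eqxx.
have M'_rank i j : i != o -> j != o -> i != j -> (rk (x_ i) <= rk (x_ j))%N -> M' i j = 0.
  by move=> nio njo /negbTE nij le_ij; rewrite M'E // nij.
have M'_c i : i != o -> \sum_j M' i j * c (x_ j) = 0.
  move=> nio; under eq_bigr => j _ do rewrite mulrBl -mulrA.
  rewrite sumrB -mulr_sumr !dfa_id_minus_c xo c_root (c_step (nroot i nio)) /di.
  by case: (d _); rewrite ?mul1r ?mul0r; ring.
split.
  rewrite /bowen_franks_det.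
  rewrite (det_rooted (rk := fun i => rk (x_ i)) (c := fun i => c (x_ i)) di_o) //.
  by rewrite dfa_id_minus_c xo c_root.
apply: (@bowen_franks_cyclic _ _ o) => i.
exact: (rows_multiple_of_root (rk := fun i => rk (x_ i)) (d := di)).
Qed.

End AutomatonDeterminant.

(** * From automata reading blocks to automata reading letters *)

Section SubAutomaton.

Variables (S : finType) (V : choiceType) (vs : seq V) (delta : V -> S -> option V).
Hypothesis closed_vs : forall x a y, x \in vs -> delta x a = Some y -> y \in vs.

(** States carry counters, so [V] may be infinite. Since [vs] is closed, [insub] never fails on the
    target of a transition and runs are unchanged. *)
Definition sub_delta (x : seq_sub vs) (a : S) : option (seq_sub vs) :=
  obind insub (delta (val x) a).

Lemma sub_deltaE x a : omap val (sub_delta x a) = delta (val x) a.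
Proof.
rewrite /sub_delta; case xa : (delta _ a) => [y|] //=.
by rewrite insubT ?(closed_vs (valP x) xa).
Qed.

Lemma sub_runE x u : omap val (run sub_delta x u) = run delta (val x) u.
Proof.
elim: u x => //= a u IHu x; rewrite -sub_deltaE.
by case: (sub_delta x a) => //= y; rewrite IHu.
Qed.

Variable L : seq (seq S).

Hypothesis run_flatten : forall s, {subset s <= L} ->
  exists2 x, x \in vs & run delta x (flatten s).
Hypothesis infix_flatten : exists k, forall x u v, x \in vs -> (k <= size u)%N ->
  run delta x (u ++ v) -> exists s, {subset s <= L} /\ infix v (flatten s).
Hypothesis cycle_unique : forall x y u, x \in vs -> y \in vs -> u != [::] ->
  run delta x u = Some x -> run delta y u = Some y -> x = y.

Variables (root : V) (rk : V -> nat) (d : pred V) (c : V -> int).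
Local Notation val_at x a := (oapp c 0 (delta x a)).
Hypothesis root_vs : root \in vs.
Hypothesis d_root : ~~ d root.
Hypothesis c_root : c root = 1.
Hypothesis rk_step : forall x a y, x \in vs -> x != root -> delta x a = Some y ->
  ~~ (d x && (delta root a == Some y)) -> (rk y < rk x)%N.
Hypothesis rk_root_step : forall x a y, x \in vs -> x != root -> d x ->
  delta root a = Some y -> delta x a != Some y -> (rk y < rk x)%N.
Hypothesis c_step : forall x, x \in vs -> x != root ->
  c x = \sum_a val_at x a + (if d x then 1 - \sum_a val_at root a else 0).

Lemma automaton_bowen_franks : exists (n : nat) (A : 'M[nat]_n),
  [/\ conjugate (renewal_system L) (edge_shift A),
      cyclic_zmod (bowen_franks_group A)
    & bowen_franks_det A = 1 - \sum_a val_at root a].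
Proof.
exists #|{: seq_sub vs}|, (dfa_mx sub_delta).
pose r : seq_sub vs := SeqSub root_vs.
have valE x a : oapp (c \o val) 0 (sub_delta x a) = val_at (val x) a.
  by rewrite -sub_deltaE; case: (sub_delta x a).
have someE x a y : (sub_delta x a == Some y) = (delta (val x) a == Some (val y)).
  by rewrite -sub_deltaE; case: (sub_delta x a).
have [|||||det cyc] := @dfa_det_cyclic _ _ sub_delta r (rk \o val) (d \o val) (c \o val).
- exact: d_root.
- exact: c_root.
- move=> x a y xr /eqP; rewrite !someE => /eqP; exact: rk_step (valP x) xr.
- move=> x a y xr dx /eqP; rewrite !someE => /eqP; exact: rk_root_step (valP x) xr dx.
- move=> x xr /=; under eq_bigr => a _ do rewrite valE.
  under [X in 1 - X]eq_bigr => a _ do rewrite valE.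
  exact: c_step (valP x) xr.
split=> //; last by rewrite det; under eq_bigr => a _ do rewrite valE.
have someR x u y : run sub_delta x u = Some y -> run delta (val x) u = Some (val y).
  by rewrite -sub_runE => ->.
have isSomeR x u : isSome (run sub_delta x u) = isSome (run delta (val x) u).
  by rewrite -sub_runE; case: (run _ x u).
apply: dfa_conjugate.
- move=> x y u un0 /someR xu /someR yu; apply: val_inj.
  exact: cycle_unique (valP x) (valP y) un0 xu yu.
- move=> s /run_flatten[x x_vs xs].
  by exists (SeqSub x_vs); rewrite isSomeR.
have [k kP] := infix_flatten; exists k => x u v le_k; rewrite isSomeR.
exact: kP (valP x) le_k.
Qed.

End SubAutomaton.

(** * Spelling blocks letter by letter *)

Section BlockAutomaton.

Variables (S Blk : finType) (wd : Blk -> seq S).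
Hypothesis wd_neq0 : forall b, wd b != [::].
Hypothesis wd_disjoint : forall a b b', a \in wd b -> a \in wd b' -> b = b'.
Hypothesis wd_rot : forall b q, (0 < q < size (wd b))%N -> rot q (wd b) != wd b.

Variables (Q : choiceType) (vs : seq Q) (delta : Q -> Blk -> option Q).
Hypothesis closed_vs : forall x b y, x \in vs -> delta x b = Some y -> y \in vs.

(* [inl x] is a state of [delta]; in [inr (b, t, q)] the first [q] letters of
   [wd b] have been read and [t] is the state to be reached at its end. *)
Local Notation V := (Q + Blk * Q * nat)%type.

Definition inside (b : Blk) (t : Q) (q : nat) : V :=
  if q == size (wd b) then inl t else inr (b, t, q).

Definition block_from (a : S) : option Blk := [pick b | ohead (wd b) == Some a].

Definition letter_delta (z : V) (a : S) : option V :=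
  match z with
  | inl x => obind (fun b => omap (fun t => inside b t 1) (delta x b)) (block_from a)
  | inr (b, t, q) => if onth (wd b) q == Some a then Some (inside b t q.+1) else None
  end.

Local Notation step := letter_delta.
Local Notation flat v := (flatten (map wd v)).

(** Every [t] in [vs] is allowed, even if no state leads to [t] by [b]. Then [inr (b, t, 1)] has no
    incoming edge, so no bi-infinite path passes through these states, although a finite run may
    start there. *)
Definition letter_states : seq V :=
  map inl vs ++ [seq inr (bt, q) | bt <- [seq (b, t) | b <- enum Blk, t <- vs],
                                   q <- iota 1 (size (wd bt.1)).-1].

Lemma wd_gt0 b : (0 < size (wd b))%N.
Proof. by rewrite lt0n size_eq0. Qed.

Lemma mem_letter_states z : z \in letter_states =
  match z with
  | inl x => x \in vs
  | inr (b, t, q) => (t \in vs) && (0 < q < size (wd b))%N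
  end.
Proof.
rewrite mem_cat; case: z => [x|[[b t] q]].
  rewrite (mem_map (@inl_inj _ _)); case: (x \in vs) => //=.
  by apply/negP => /allpairsPdep[bt [q [_ _]]].
rewrite (_ : _ \in map inl vs = false) /=; last by apply/negP => /mapP[].
apply/allpairsPdep/andP => [[bt [q' [bt_in q_in e]]]|[t_in q_in]].
  case: e bt_in q_in => <- <- /allpairsP[[b' t'] /= [_ t'_in [-> ->]]]; rewrite mem_iota.
  by move: (wd_gt0 b'); split=> //; lia.
exists (b, t), q; split=> //; last by rewrite mem_iota /=; move: (wd_gt0 b); lia.
by apply/allpairsP; exists (b, t); rewrite mem_enum.
Qed.

Lemma block_from_mem a b : block_from a = Some b -> a \in wd b.
Proof.
rewrite /block_from; case: pickP => // b' /eqP ha [<-].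
by case: (wd b') ha => // a' w [->]; rewrite mem_head.
Qed.

Lemma block_from_head a b w : wd b = a :: w -> block_from a = Some b.
Proof.
move=> wb; have ab : a \in wd b by rewrite wb mem_head.
case ba : (block_from a) => [b'|].
  by rewrite (wd_disjoint (block_from_mem ba) ab).
by move: ba; rewrite /block_from; case: pickP => // /(_ b); rewrite wb /= eqxx.
Qed.

Lemma block_fromE a b : (block_from a == Some b) = (ohead (wd b) == Some a).
Proof.
apply/eqP/eqP => [|].
  by rewrite /block_from; case: pickP => // b' /eqP ha [<-].
case wb: (wd b) => [//|a' w] [<-]; exact: block_from_head wb.
Qed.

Lemma letter_states_closed z a z' : z \in letter_states -> step z a = Some z' ->
  z' \in letter_states.
Proof.
have insideP b t q : t \in vs -> (0 < q <= size (wd b))%N -> inside b t q \in letter_states.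
  move=> t_vs q_le; rewrite /inside; case: eqP => qs; rewrite mem_letter_states t_vs //=.
  by move: qs; lia.
rewrite mem_letter_states; case: z => [x x_vs|[[b t] q] /andP[t_vs q_lt]] /=.
  case ba : (block_from a) => [b|] //=; case xb : (delta x b) => [t|] //= [<-].
  by apply: insideP; rewrite ?wd_gt0 // (closed_vs x_vs xb).
by case: ifP => // _ [<-]; apply: insideP => //; lia.
Qed.

Lemma run_inside b t q : (q <= size (wd b))%N ->
  (0 < q)%N -> run step (inside b t q) (drop q (wd b)) = Some (inl t).
Proof.
move=> q_le q_gt0; have [n] := ubnP (size (wd b) - q).
elim: n => // n IHn in q q_le q_gt0 *; move=> le_n.
rewrite /inside; case: eqP => [->|nq]; first by rewrite drop_size.
have q_lt : (q < size (wd b))%N by lia.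
case wb : (wd b) => [|a0 w0]; first by rewrite wb in q_lt.
rewrite -wb (drop_nth a0) //= onthE (nth_map a0) // eqxx /=.
by apply: IHn; lia.
Qed.

Lemma run_block x b t : delta x b = Some t -> run step (inl x) (wd b) = Some (inl t).
Proof.
move=> xb; case wb : (wd b) => [|a w]; first by have := wd_neq0 b; rewrite wb.
rewrite /= (block_from_head wb) /= xb /=.
by have := @run_inside b t 1 (wd_gt0 b) isT; rewrite wb /= drop0.
Qed.

Lemma run_blocks x v y : run delta x v = Some y -> run step (inl x) (flat v) = Some (inl y).
Proof.
elim: v x => [|b v IHv] x /=; first by case=> ->.
by case xb : (delta x b) => [t|] //= /IHv ty; rewrite run_cat (run_block xb).
Qed.

Lemma run_inside_inv b t q u z : (0 < q)%N -> (q + size u <= size (wd b))%N ->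
  run step (inside b t q) u = Some z ->
  u = take (size u) (drop q (wd b)) /\ z = inside b t (q + size u).
Proof.
elim: u q => [|a u IHu] q q_gt0 /=; first by rewrite addn0 take0 => _ [<-].
move=> q_le; rewrite /inside; case: eqP => [|nq] /=; first by lia.
case: eqP => //= qa qu; have [||uE zE] := IHu q.+1 _ _ qu; [lia|lia|].
split; last by rewrite -addSnnS.
have q_lt : (q < size (wd b))%N by lia.
rewrite (drop_nth a) //= -uE.
by move: qa; rewrite onthE (nth_map a) // => -[->].
Qed.

Lemma run_start a x u z : run step (inl x) (a :: u) = Some z ->
  exists b t, [/\ delta x b = Some t, ohead (wd b) = Some a & run step (inside b t 1) u = Some z].
Proof.
move=> /=; case ba : (block_from a) => [b|] //=.
case xb : (delta x b) => [t|] //= tu; exists b, t; split=> //.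
by apply/eqP; rewrite -block_fromE ba.
Qed.

(** One letter identifies its block, so a run leaving a block boundary with a letter of [b] is
    forced to spell [b]. *)
Lemma run_start_inv b x u z a : a \in wd b -> ohead u = Some a ->
  (size u <= size (wd b))%N -> run step (inl x) u = Some z ->
  u = take (size u) (wd b) /\ exists t, z = inside b t (size u).
Proof.
case: u => // a' u ab [->] le_u /run_start[b' [t [_ hb' tu]]].
have ab' : a \in wd b' by case: (wd b') hb' => // ? ? [->]; rewrite mem_head.
move: hb' tu; rewrite -{b' ab'}(wd_disjoint ab ab') => hb.
move=> /run_inside_inv[//|//|eu ->]; split; last by exists t.
move: hb eu; case: (wd b) => //= a0 w [->]; rewrite drop0 => {1}->.
by [].
Qed.

Let K := (\max_b size (wd b))%N.

Lemma size_wd_le b : (size (wd b) <= K)%N.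
Proof. exact: leq_bigmax. Qed.

(* Being in the middle of a block while another run is at its start would
   exhibit that block as one of its own proper rotations. *)
Lemma phase_unique x b t q u : (0 < q < size (wd b))%N -> (K <= size u)%N ->
  run step (inl x) u -> run step (inr (b, t, q)) u -> False.
Proof.
move=> /andP[q_gt0 q_lt] le_u xu yu.
set n := size (wd b) in q_lt; have le_n : (n <= size u)%N := leq_trans (size_wd_le b) le_u.
move: xu yu; rewrite -(cat_take_drop n u); set w := take n u => xu yu.
have size_w : size w = n by rewrite size_takel.
have [x' xw _] := run_catl xu; have [y' yw _] := run_catl yu => {xu yu}.
have inE : inr (b, t, q) = inside b t q.
  by rewrite /inside; case: eqP => // qn; rewrite qn ltnn in q_lt.
move: yw; rewrite inE -(cat_take_drop (n - q) w) run_cat.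
case yw1 : (run _ _ _) => [z|] //= zw.
have [|//|] := run_inside_inv _ _ yw1; first by [].
  by rewrite size_takel ?size_w; lia.
rewrite size_takel ?size_w ?leq_subr // subnKC 1?ltnW //.
rewrite [take _ (drop _ _)]take_oversize ?size_drop // => w1 zE.
have zt : z = inl t by rewrite zE /inside eqxx.
case ew : w => [|a w']; first by move: size_w; rewrite ew /=; lia.
have ab : a \in wd b.
  have : a \in take (n - q) w.
    have : (0 < n - q)%N by rewrite subn_gt0.
    by rewrite ew; case: (n - q)%N => [|k] //= _; rewrite mem_head.
  by rewrite w1 => /mem_drop.
have [|//|] := run_start_inv ab _ _ xw; [by rewrite ew|by rewrite size_w|].
rewrite size_w take_size => wE _.
case ew2 : (drop (n - q) w) => [|a2 w2].
  by have := congr1 size ew2; rewrite size_drop size_w /=; lia.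
have a2b : a2 \in wd b.
  by rewrite -wE; apply: (@mem_drop (n - q)); rewrite ew2 mem_head.
move: zw; rewrite zt => zw.
have [|//|] := run_start_inv a2b _ _ zw; [by rewrite ew2| |].
  by rewrite size_drop size_w; lia.
rewrite size_drop size_w subKn 1?ltnW // => w2E _.
have /eqP[] : rot q (wd b) != wd b by rewrite wd_rot ?q_gt0.
by rewrite /rot -w1 -w2E cat_take_drop wE.
Qed.

Lemma run_letters_inv x u z : run step (inl x) u = Some z ->
  exists v x', run delta x v = Some x' /\
   ((z = inl x' /\ u = flat v) \/
    exists b t q, [/\ (0 < q < size (wd b))%N, delta x' b = Some t,
      z = inr (b, t, q) & u = flat v ++ take q (wd b)]).
Proof.
elim/last_ind: u z => [|u a IHu] z /=.
  by case=> <-; exists [::], x; split=> //; left.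
rewrite run_rcons; case xu : (run step _ u) => [y|] //= ya.
(* When [q] is the length of [b], the block is complete and joins [v]; otherwise it remains the
   partial block. *)
have advance v x' b t q : run delta x v = Some x' -> delta x' b = Some t ->
  (0 < q <= size (wd b))%N ->
  exists v0 x0, run delta x v0 = Some x0 /\
   ((inside b t q = inl x0 /\ flat v ++ take q (wd b) = flat v0) \/
    exists b0 t0 q0, [/\ (0 < q0 < size (wd b0))%N, delta x0 b0 = Some t0,
      inside b t q = inr (b0, t0, q0) & flat v ++ take q (wd b) = flat v0 ++ take q0 (wd b0)]).
  move=> xv x'b q_le; rewrite /inside; case: eqP => [->|nq].
    exists (rcons v b), t; rewrite run_rcons xv /= x'b; split=> //; left; split=> //.
    by rewrite take_size map_rcons -cats1 flatten_cat /= cats0.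
  by exists v, x'; split=> //; right; exists b, t, q; split=> //; lia.
have [v [x' [xv [[yE uE]|[b [t [q [q_lt x'b yE uE]]]]]]]] := IHu _ xu; rewrite yE in ya.
  move: ya => /=; case ba : (block_from a) => [b|] //=.
  case x'b : (delta x' b) => [t|] //= [<-].
  have -> : rcons u a = flat v ++ take 1 (wd b).
    rewrite uE -cats1; congr (_ ++ _); move/eqP: ba; rewrite block_fromE.
    by case: (wd b) => // ? ? /eqP[->]; rewrite /= take0.
  by apply: advance xv x'b _; rewrite wd_gt0.
move: ya => /=; case: eqP => // qa [<-].
have -> : rcons u a = flat v ++ take q.+1 (wd b).
  rewrite uE -cats1 -catA cats1; congr (_ ++ _); move: q_lt qa => /andP[_ q_lt].
  by rewrite onthE (nth_map a) // => -[{1}<-]; rewrite -take_nth.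
by apply: advance xv x'b _; lia.
Qed.

(** A block that [delta] refuses is already refused at its first letter. *)
Lemma run_blocks_inv y v z : run step (inl y) (flat v) = Some z ->
  exists2 y', run delta y v = Some y' & z = inl y'.
Proof.
elim: v y => [|b v IHv] y /=; first by case=> <-; exists y.
case yb : (delta y b) => [t|] /=; first by rewrite run_cat (run_block yb) => /IHv.
case wb : (wd b) => [|a w]; first by have := wd_neq0 b; rewrite wb.
by rewrite /= (block_from_head wb) /= yb.
Qed.

Lemma run_reaches_block z u : z \in letter_states -> (K <= size u)%N -> run step z u ->
  exists i x, [/\ (i <= K)%N, x \in vs & run step z (take i u) = Some (inl x)].
Proof.
rewrite mem_letter_states; case: z => [x|[[b t] q]].
  by move=> x_vs _ _; exists 0%N, x; rewrite take0.
move=> /andP[t_vs /andP[q_gt0 q_lt]] le_u.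
have size_b := size_wd_le b.
have inE : inr (b, t, q) = inside b t q.
  by rewrite /inside; case: eqP => // qn; rewrite qn ltnn in q_lt.
rewrite -{1}(cat_take_drop (size (wd b) - q) u) inE => run_u.
have [z zu _] := run_catl run_u.
exists (size (wd b) - q)%N, t; split=> //; first by lia.
have [|_ zE] := run_inside_inv q_gt0 _ zu; first by rewrite size_takel; lia.
by rewrite zu zE size_takel ?subnKC /inside ?eqxx //; lia.
Qed.

Lemma run_letter_states z u z' : z \in letter_states -> run step z u = Some z' ->
  z' \in letter_states.
Proof.
elim: u z => [|a u IHu] z /=; first by move=> zP [<-].
by move=> zP; case za : (step z a) => [t|] //=; apply/IHu/(letter_states_closed zP za).
Qed.

Variable L : seq (seq S).

Hypothesis run_blocks_flatten : forall s, {subset s <= L} ->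
  exists x v, [/\ x \in vs, run delta x v & flatten s = flat v].
Hypothesis infix_blocks_flatten : forall x v, x \in vs -> run delta x v ->
  exists s, {subset s <= L} /\ infix (flat v) (flatten s).
Hypothesis cycle_blocks_unique : forall x y v, x \in vs -> y \in vs -> v != [::] ->
  run delta x v = Some x -> run delta y v = Some y -> x = y.

Lemma letter_run_flatten s : {subset s <= L} ->
  exists2 z, z \in letter_states & run step z (flatten s).
Proof.
move=> /run_blocks_flatten[x [v [x_vs xv ->]]].
exists (inl x); first by rewrite mem_letter_states.
by move: xv; case e : (run delta x v) => [y|] // _; rewrite (run_blocks e).
Qed.

Lemma letter_infix_flatten z u v : z \in letter_states -> (K <= size u)%N ->
  run step z (u ++ v) -> exists s, {subset s <= L} /\ infix v (flatten s).
Proof.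
move=> zP le_u zuv; have [y zu _] := run_catl zuv.
have [|i [x [_ x_vs xi]]] := run_reaches_block zP le_u; first by rewrite zu.
move: zuv; rewrite -(cat_take_drop i u) -catA run_cat xi /=.
case xv : (run _ _ _) => [z'|] // _.
have [w [x' [xw zE]]] := run_letters_inv xv.
suff [w' [xw' uvE]] : exists w', isSome (run delta x w') /\ infix (drop i u ++ v) (flat w').
  have [s [sL s_w']] := infix_blocks_flatten x_vs xw'.
  exists s; split=> //; apply: infix_trans s_w'; apply: infix_trans uvE.
  by apply/infixP; exists (drop i u), [::]; rewrite cats0.
case: zE => [[_ ->]|[b [t [q [_ x'b _ ->]]]]].
  by exists w; rewrite xw infix_refl.
exists (rcons w b); rewrite run_rcons xw /= x'b; split=> //.
rewrite map_rcons -cats1 flatten_cat /= cats0 -{2}(cat_take_drop q (wd b)) catA.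
by apply/infixP; exists [::]; eexists.
Qed.

Lemma letter_cycle_unique z z' u : z \in letter_states -> z' \in letter_states ->
  u != [::] -> run step z u = Some z -> run step z' u = Some z' -> z = z'.
Proof.
(* At most [K] letters of [U] bring the first run to a block boundary; at least [K] letters then
   remain, enough for [phase_unique] to put the second run at a boundary too. *)
move=> zP z'P un0 zu z'u; pose U := flatten (nseq (K + K).+1 u).
have le_U : (K + K < size U)%N.
  rewrite size_flatten /shape map_nseq sumn_nseq mulnC -[leqLHS]muln1 leq_mul2l.
  by rewrite lt0n size_eq0 un0 orbT.
have zU : run step z U = Some z := run_cycle _ zu.
have z'U : run step z' U = Some z' := run_cycle _ z'u.
clearbody U.
have [||i [x [i_le x_vs zx]]] := @run_reaches_block z U zP.
- exact: leq_trans (leq_addr K K) (ltnW le_U).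
- by rewrite zU.
have xz : run step (inl x) (drop i U) = Some z.
  by move: zU; rewrite -{1}(cat_take_drop i U) run_cat zx.
move: (z'U); rewrite -{1}(cat_take_drop i U) run_cat.
case z'y : (run step z' (take i U)) => [y|] //= yz'.
have le_d : (K <= size (drop i U))%N by rewrite size_drop; move: le_U i_le; lia.
have := run_letter_states z'P z'y; rewrite mem_letter_states.
case: y z'y yz' => [y|[[b t] q]] z'y yz'; last first.
  move=> /andP[_ q_lt]; have := @phase_unique x b t q (drop i U) q_lt le_d.
  by rewrite xz yz' => /(_ isT isT).
(* Rotated to this boundary, the cycle becomes a sequence of whole blocks, the same for both
   states. *)
move=> y_vs; have cycx : run step (inl x) (drop i U ++ take i U) = Some (inl x).
  by rewrite run_cat xz.
have cycy : run step (inl y) (drop i U ++ take i U) = Some (inl y).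
  by rewrite run_cat yz'.
have [v [x' [xv [[[xx'] eU]|[? [? [? [? _ ?]]]]]]]] := run_letters_inv cycx => //.
rewrite -xx' in xv; rewrite eU in cycy; have [y' yv [yy']] := run_blocks_inv cycy.
rewrite -yy' in yv; have xy : x = y.
  apply: cycle_blocks_unique xv yv => //; apply: contra_eq_neq eU => ->.
  rewrite -size_eq0 size_cat addnC -size_cat cat_take_drop.
  by rewrite -lt0n (leq_trans _ le_U).
by move: xz; rewrite xy yz' => -[].
Qed.

Variables (root : Q) (rk : Q -> nat) (d : pred Q) (c : Q -> int).
Local Notation val_at x b := (oapp c 0 (delta x b)).
Hypothesis root_vs : root \in vs.
Hypothesis d_root : ~~ d root.
Hypothesis c_root : c root = 1.
Hypothesis rk_step : forall x b y, x \in vs -> x != root -> delta x b = Some y ->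
  ~~ (d x && (delta root b == Some y)) -> (rk y < rk x)%N.
Hypothesis rk_root_step : forall x b y, x \in vs -> x != root -> d x ->
  delta root b = Some y -> delta x b != Some y -> (rk y < rk x)%N.
Hypothesis c_step : forall x, x \in vs -> x != root ->
  c x = \sum_b val_at x b + (if d x then 1 - \sum_b val_at root b else 0).

(** A drop of [rk] by one makes room for the descent through a block, which has at most [K]
    letters. *)
Definition letter_rk (z : V) : nat :=
  match z with
  | inl x => K.+1 * rk x
  | inr (b, t, q) => K.+1 * rk t + (K.+1 - q)
  end.

Definition letter_d (z : V) : bool := if z is inl x then d x else false.

(** A state inside a block has one outgoing edge, so its value is that of the state ahead. *)
Definition letter_c (z : V) : int :=
  match z with inl x => c x | inr (b, t, q) => c t end.

Lemma letter_c_inside b t q : letter_c (inside b t q) = c t.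
Proof. by rewrite /inside; case: ifP. Qed.

Lemma letter_rk_inside b t q :
  (letter_rk (inside b t q) <= K.+1 * rk t + (K.+1 - q))%N.
Proof. by rewrite /inside; case: ifP => //= _; rewrite leq_addr. Qed.

Lemma letter_rk_lt x b t : (rk t < rk x)%N ->
  (letter_rk (inside b t 1) < letter_rk (inl x))%N.
Proof.
move=> lt_tx; apply: leq_ltn_trans (letter_rk_inside _ _ _) _ => /=.
by apply: (@leq_trans (K.+1 * (rk t).+1)); rewrite ?leq_mul2l ?lt_tx // mulnS; lia.
Qed.

Lemma sum_letter_c x :
  \sum_a oapp letter_c 0 (step (inl x) a) = \sum_b val_at x b.
Proof.
transitivity (\sum_a \sum_b (ohead (wd b) == Some a)%:R * val_at x b).
  apply: eq_bigr => a _ /=; case ba : (block_from a) => [b|] /=.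
    rewrite (bigD1 b) //= -block_fromE ba eqxx mul1r big1 ?addr0.
      by case: (delta x b) => //= t; rewrite letter_c_inside.
    move=> b' nb; rewrite -block_fromE ba (_ : (Some b == Some b') = (b == b')) //.
    by rewrite eq_sym (negbTE nb) mul0r.
  by rewrite big1 // => b _; rewrite -block_fromE ba mul0r.
rewrite exchange_big; apply: eq_bigr => b _ /=.
case wb : (wd b) => [|a w]; first by have := wd_neq0 b; rewrite wb.
rewrite (bigD1 a) //= eqxx mul1r big1 ?addr0 // => a' na.
by rewrite (_ : (Some a == Some a') = (a == a')) // eq_sym (negbTE na) mul0r.
Qed.

Lemma block_bowen_franks : exists (n : nat) (A : 'M[nat]_n),
  [/\ conjugate (renewal_system L) (edge_shift A),
      cyclic_zmod (bowen_franks_group A)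
    & bowen_franks_det A = 1 - \sum_b val_at root b].
Proof.
rewrite -sum_letter_c.
apply: (@automaton_bowen_franks S V letter_states step letter_states_closed L
         letter_run_flatten _ letter_cycle_unique (inl root) letter_rk letter_d letter_c).
- by exists K; exact: letter_infix_flatten.
- by rewrite mem_letter_states.
- exact: d_root.
- exact: c_root.
- move=> [x|[[b t] q]] a z; rewrite mem_letter_states;
    [move=> x_vs nx /=|move=> /andP[t_vs q_lt] _ /=].
    case ba : (block_from a) => [b|] //=; case xb : (delta x b) => [t|] //= [<-] ndx.
    apply: letter_rk_lt; apply: rk_step xb _ => //; apply: contra ndx => /andP[-> /eqP->].
    exact: eqxx.
  case: eqP => // _ [<-] _; apply: leq_ltn_trans (letter_rk_inside _ _ _) _.
  by move: (size_wd_le b) q_lt => /=; lia.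
- move=> [x|//] a z; rewrite mem_letter_states => x_vs nx /= dx.
  case ba : (block_from a) => [b|] //=; case rb : (delta root b) => [t|] //= [<-] xb.
  apply: letter_rk_lt; apply: rk_root_step rb _ => //; apply: contraNneq xb => ->.
  exact: eqxx.
move=> [x|[[b t] q]]; rewrite mem_letter_states; [move=> x_vs nx|move=> /andP[t_vs q_lt] _].
  by rewrite !sum_letter_c; exact: c_step.
rewrite addr0 /=; case wb : (wd b) => [|a0 w]; first by rewrite wb /= andbF in q_lt.
have q_lt' : (q < size (wd b))%N by case/andP: q_lt.
rewrite -wb (bigD1 (nth a0 (wd b) q)) //= onthE (nth_map a0) // eqxx /= letter_c_inside.
rewrite big1 ?addr0 // => a na; case: eqP => // -[qa].
by rewrite qa eqxx in na.
Qed.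

End BlockAutomaton.

(** * The automaton of a union of lists in the class [B] *)

(* [Kchain j 1] is the kind of the words [alpha_i] of [W_j], [Kchain j k] with
   [k >= 2] that of its words [gamma_(k,i)]. *)
Inductive block_kind (m : nat) :=
  | Kfree
  | Kalphat of 'I_m
  | Kbeta of 'I_m
  | Kchain of 'I_m & nat.

Arguments Kfree {m}.

HB.instance Definition _ (m : nat) := gen_eqMixin (block_kind m).

(* [Free (Some (j, k))]: the last blocks read are [alpha gamma_2 .. gamma_k]
   of the list [W_j].
   [Pending j l t q]: [q] blocks have been read of a word starting with
   [beta_l^N], which has to be continued to [beta_l^N alphat gamma_2 .. gamma_r]
   if [t] holds, and only to [beta_l^N] otherwise, because then
   [alpha gamma_2 .. gamma_r] precedes it. *)
Inductive block_state (m : nat) (Blk : Type) :=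
  | Free of option ('I_m * nat)
  | Pending of 'I_m & Blk & bool & nat.

Arguments Free {m Blk}.
Arguments Pending {m Blk}.

HB.instance Definition _ (m : nat) (Blk : Type) := gen_eqMixin (block_state m Blk).
HB.instance Definition _ (m : nat) (Blk : Type) := gen_choiceMixin (block_state m Blk).

Section ClassAutomaton.

Variables (m : nat) (Blk : finType) (r N : 'I_m -> nat) (kind : Blk -> block_kind m).
Hypothesis r_ge2 : forall j, (2 <= r j)%N.
Hypothesis N_gt0 : forall j, (0 < N j)%N.
Hypothesis chain_range : forall b j k, kind b = Kchain j k -> (0 < k <= r j)%N.

Local Notation state := (block_state m Blk).
Local Notation root := (Free None : state).

(** The [r j] further blocks are one [alphat] and one [gamma_k] for each [k] from [2] to [r j]. *)
Definition pend_length (j : 'I_m) (t : bool) : nat := N j + (if t then r j else 0).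

Definition pend (j : 'I_m) (l : Blk) (t : bool) (q : nat) : state :=
  if q == pend_length j t then Free None else Pending j l t q.

(** After a complete chain, letting [beta^N] end the word loses nothing: a following
    [alphat gamma_2 .. gamma_r] can still be read as separate words. This is what makes a
    deterministic reading possible. *)
Definition free_step (o : option ('I_m * nat)) (b : Blk) : state :=
  match kind b with
  | Kfree | Kalphat _ => Free None
  | Kchain j k =>
      if (k == 1) || (o == Some (j, k.-1)) then Free (Some (j, k)) else Free None
  | Kbeta j => pend j b (o != Some (j, r j)) 1
  end.

Definition tail_kind (j : 'I_m) (i : nat) : block_kind m :=
  if i == 0 then Kalphat j else Kchain j i.+1.

Definition expects (j : 'I_m) (l : Blk) (t : bool) (q : nat) (b : Blk) : bool :=
  if (q < N j)%N then b == l else t && (kind b == tail_kind j (q - N j)).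

Definition block_delta (x : state) (b : Blk) : option state :=
  match x with
  | Free o => Some (free_step o b)
  | Pending j l t q => if expects j l t q b then Some (pend j l t q.+1) else None
  end.

Local Notation delta := block_delta.

Definition state_ok (x : state) : bool :=
  match x with
  | Free None => true
  | Free (Some (j, k)) => (0 < k <= r j)%N
  | Pending j l t q => (kind l == Kbeta j) && (0 < q < pend_length j t)%N
  end.

Definition block_states : seq state :=
  let R := (\max_j (N j + r j))%N in
  [seq x <- Free None
            :: [seq Free (Some (p.1, val p.2)) | p : 'I_m * 'I_R.+1]
            ++ [seq Pending p.1.1 p.1.2 p.2.1 (val p.2.2)
               | p : ('I_m * Blk) * (bool * 'I_R.+1)]
  | state_ok x].

Lemma mem_block_states x : (x \in block_states) = state_ok x.
Proof.
rewrite mem_filter; case: (boolP (state_ok x)) => //= ok_x.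
set R := (\max_j (N j + r j))%N.
have leR j : (N j + r j <= R)%N by apply: leq_bigmax.
rewrite in_cons mem_cat; case: x ok_x => [[[j k]|]|j l t q] /= ok_x.
- apply/orP; right; apply/orP; left; apply/mapP; exists (j, inord k).
    by rewrite mem_enum.
  by rewrite /= inordK //; move: (leR j); lia.
- by rewrite eqxx.
apply/orP; right; apply/orP; right; apply/mapP; exists ((j, l), (t, inord q)).
  by rewrite mem_enum.
rewrite /= inordK //; move: ok_x (leR j); rewrite /pend_length => /andP[_].
by case: t; lia.
Qed.

Lemma tail_pend_length j : (N j < pend_length j true)%N.
Proof. by rewrite /pend_length -addn1 leq_add2l; apply: leq_trans (r_ge2 j). Qed.

Lemma pend_ok j l t q : kind l = Kbeta j -> (0 < q <= pend_length j t)%N ->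
  state_ok (pend j l t q).
Proof. by rewrite /pend => kl q_le; case: eqP => //= nq; rewrite kl eqxx /=; lia. Qed.

Lemma pend_length_ge j t : (N j <= pend_length j t)%N.
Proof. exact: leq_addr. Qed.

Lemma block_delta_ok x b y : state_ok x -> delta x b = Some y -> state_ok y.
Proof.
case: x => [o|j l t q] /= ok_x.
  case=> <-; rewrite /free_step; case kb : (kind b) => [|j|j|j k] //.
    by apply: pend_ok => //=; apply: leq_trans (N_gt0 j) (pend_length_ge _ _).
  by case: ifP => //= _; exact: chain_range kb.
case: ifP => // _ [<-]; case/andP: ok_x => /eqP kl q_lt.
by apply: pend_ok => //; lia.
Qed.

Lemma block_states_closed x b y : x \in block_states -> delta x b = Some y ->
  y \in block_states.
Proof. by rewrite !mem_block_states; apply: block_delta_ok. Qed.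

(** * Synchronisation of states *)

Inductive merges : state -> state -> Prop :=
  | merges_refl x : merges x x
  | merges_step x y : (forall b x' y', delta x b = Some x' -> delta y b = Some y' ->
      merges x' y') -> merges x y.

Lemma merges_sym x y : merges x y -> merges y x.
Proof.
elim=> {x y} [x|x y _ IH]; first exact: merges_refl.
by apply: merges_step => b y' x' yb xb; exact: IH xb yb.
Qed.

(** After the first block, [x'] and [y'] lie on the cycle rotated by that block, so they are equal
    by induction; the rest of the cycle then carries them to the same state. *)
Lemma merges_cycle x y : merges x y -> forall v, v != [::] ->
  run delta x v = Some x -> run delta y v = Some y -> x = y.
Proof.
elim=> {x y} [//|x y _ IH [|b v] // _ /=].
case xb : (delta x b) => [x'|] //=; case yb : (delta y b) => [y'|] //= x'v y'v.
suff eq_xy : x' = y' by move: x'v y'v; rewrite eq_xy => -> [].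
apply: (IH b x' y' xb yb (rcons v b)).
- by rewrite -size_eq0 size_rcons.
- by rewrite run_rcons x'v /= xb.
- by rewrite run_rcons y'v /= yb.
Qed.

Lemma pending_step j l t q b x : delta (Pending j l t q) b = Some x ->
  expects j l t q b /\ x = pend j l t q.+1.
Proof. by rewrite /=; case: ifP => // e [<-]. Qed.

Lemma free_step_tail o b j i : kind b = tail_kind j i ->
  exists o', free_step o b = Free o' /\ (o = None -> o' = None).
Proof.
rewrite /free_step /tail_kind => ->; case: i => [|i] /=; first by exists None.
by case: ifP => [/eqP->|_]; [exists (Some (j, i.+2))|exists None].
Qed.

Lemma expects_tail j l t q b : (N j <= q)%N -> expects j l t q b ->
  kind b = tail_kind j (q - N j).
Proof. by rewrite /expects ltnNge => -> /= /andP[_ /eqP]. Qed.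

(** The tail blocks expected by the pending state keep the root where it is, until the pending state
    reaches the root as well. *)
Lemma merges_root_pend j l q : (N j <= q <= pend_length j true)%N ->
  merges (Free None) (pend j l true q).
Proof.
have [n] := ubnP (pend_length j true - q); elim: n => [|n IHn] in q *; first by rewrite ltn0.
move=> le_n q_le; rewrite /pend; case: eqP => [_|nq]; first exact: merges_refl.
apply: merges_step => b x' y' [<-] /pending_step[e ->].
have [|o' [-> -> //]] := @free_step_tail None b j (q - N j).
  by apply: expects_tail e; lia.
by apply: IHn; lia.
Qed.

(** Both flags expect the same remaining [beta_l]; afterwards the false flag is at the root and the
    true one at the start of its tail. *)
Lemma merges_pend_flags j l q : (q <= N j)%N ->
  merges (pend j l false q) (pend j l true q).
Proof.
have [n] := ubnP (N j - q); elim: n => [|n IHn] in q *; first by rewrite ltn0.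
move=> le_n; rewrite leq_eqVlt => /predU1P[->|q_lt].
  rewrite {1}/pend /pend_length addn0 eqxx; apply: merges_root_pend.
  by rewrite leqnn ltnW ?tail_pend_length.
have flN : pend_length j false = N j by rewrite /pend_length addn0.
have := tail_pend_length j; rewrite /pend flN => lt_N.
rewrite !ifN; [|by apply/eqP; lia|by apply/eqP; lia].
by apply: merges_step => b x' y' /pending_step[_ ->] /pending_step[_ ->]; apply: IHn; lia.
Qed.

Lemma merges_beta j l t t' : merges (pend j l t 1) (pend j l t' 1).
Proof.
case: t t' => [] []; try exact: merges_refl; last exact: merges_pend_flags.
exact/merges_sym/merges_pend_flags.
Qed.

(** The two states differ only on the blocks prolonging the chain, which happens at most [r j - k]
    times, and on [beta], where only the flags differ. *)
Lemma merges_chain_root j k : merges (Free (Some (j, k))) (Free None).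
Proof.
have [n] := ubnP (r j - k); elim: n => [|n IHn] in k *; first by rewrite ltn0.
move=> le_n.
apply: merges_step => b x' y' [<-] [<-]; rewrite /free_step.
case kb : (kind b) => [|j'|j'|j' k']; try exact: merges_refl; first exact: merges_beta.
rewrite orbF; case: eqP => /= k'1; first exact: merges_refl.
case: eqP => [[jj' kk']|_]; last exact: merges_refl.
by have := chain_range kb; rewrite -jj'; move=> k'_le; apply: IHn; lia.
Qed.

Lemma merges_free o o' : merges (Free o) (Free o').
Proof.
apply: merges_step => b x' y' [<-] [<-]; rewrite /free_step.
case kb : (kind b) => [|j'|j'|j' k']; try exact: merges_refl; first exact: merges_beta.
case: ifP => _; case: ifP => _; try exact: merges_refl.
  exact: merges_chain_root.
exact/merges_sym/merges_chain_root.
Qed.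

Lemma merges_free_pend o j l q : (N j <= q <= pend_length j true)%N ->
  merges (Free o) (pend j l true q).
Proof.
have [n] := ubnP (pend_length j true - q); elim: n => [|n IHn] in o q *; first by rewrite ltn0.
move=> le_n q_le; rewrite /pend; case: eqP => [_|nq]; first exact: merges_free.
apply: merges_step => b x' y' [<-] /pending_step[e ->].
have [|o' [-> _]] := @free_step_tail o b j (q - N j).
  by apply: expects_tail e; lia.
by apply: IHn; lia.
Qed.

Lemma merges_tails j l q j' l' q' : (N j <= q <= pend_length j true)%N ->
  (N j' <= q' <= pend_length j' true)%N ->
  merges (pend j l true q) (pend j' l' true q').
Proof.
have [n] := ubnP (pend_length j true - q); elim: n => [|n IHn] in q q' *; first by rewrite ltn0.
move=> le_n q_le q'_le; rewrite {1}/pend; case: eqP => [_|nq].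
  exact: merges_free_pend.
rewrite /pend; case: eqP => [_|nq'].
  apply: merges_sym; have := @merges_free_pend None j l q q_le.
  by rewrite /pend; case: eqP.
apply: merges_step => b x' y' /pending_step[_ ->] /pending_step[_ ->].
by apply: IHn; lia.
Qed.

Definition reads_only (l : Blk) (x : state) : bool :=
  if x is Pending j l' t q then (q < N j)%N && (l' == l) else false.

(* Bounds the number of blocks [beta_l] of [W_j] that can be read in a row. *)
Definition beta_reserve (j : 'I_m) (x : state) : nat :=
  match x with
  | Free None => N j
  | Free (Some _) => N j + N j
  | Pending _ _ t q => (if t then N j - q else N j + N j - q)%N
  end.

Lemma beta_step j l x x' : kind l = Kbeta j -> state_ok x -> delta x l = Some x' ->
  (beta_reserve j x' < beta_reserve j x)%N /\
  (x' = Free None \/ x' = pend j l true (N j) \/ reads_only l x').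
Proof.
move=> kl; have Nj := N_gt0 j; have ltN := tail_pend_length j.
have pendP t q : (0 < q <= N j)%N ->
    (beta_reserve j (pend j l t q) <= (if t then N j - q else N j + N j - q))%N /\
    (pend j l t q = Free None \/ pend j l t q = pend j l true (N j)
     \/ reads_only l (pend j l t q)).
  move=> q_le; rewrite {1 2 5}/pend; case: eqP => [eq_q|nq] /=.
    split; last by left.
    by move: eq_q ltN; rewrite /pend_length; case: t; lia.
  split; first by [].
  case: (ltnP q (N j)) => q_lt; right; [right|left]; first by rewrite eqxx.
  have -> : q = N j by lia.
  by case: t nq => //; rewrite /pend_length; lia.
case: x => [o|j' l' t q] ok_x.
  case=> <-; rewrite /free_step kl.
  have [le_res cases] := pendP (o != Some (j, r j)) 1 Nj; split=> //.
  apply: leq_ltn_trans le_res _; case: o {cases ok_x} => [p|] /=; last by lia.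
  by case: ifP; lia.
move=> /pending_step[]; rewrite /expects; case: ltnP => [q_lt /eqP ll' ->|_ /andP[_]].
  have jj' : j' = j by move: ok_x; rewrite /= -ll' kl => /andP[/eqP[->]].
  rewrite -ll' jj' in q_lt *; have [|le_res cases] := pendP t q.+1; first by lia.
  by split=> //; apply: leq_ltn_trans le_res _ => /=; case: (t); lia.
by rewrite kl /tail_kind; case: (q - N j')%N => [|i] /eqP.
Qed.

(** A state bound to read [beta_l] imposes this block on both runs. Each reading lowers both
    reserves, so unless a run stops, both are eventually released, at the root or at the start of a
    tail. *)
Lemma merges_reads_only l x y : state_ok x -> state_ok y ->
  reads_only l x || reads_only l y -> merges x y.
Proof.
move=> ok_x ok_y only; have [j kl] : exists j, kind l = Kbeta j.
  by case/orP: only; [move: ok_x; case: x|move: ok_y; case: y] => // j l' t q;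
    move=> /andP[/eqP kl _] /andP[_ /eqP<-]; exists j.
have [n] := ubnP (beta_reserve j x + beta_reserve j y).
elim: n => [|n IHn] in x y ok_x ok_y only *; first by rewrite ltn0.
move=> le_n.
have only_l b z z' : reads_only l z -> delta z b = Some z' -> b = l.
  case: z => // j' l' t q /= /andP[q_lt /eqP ->].
  by rewrite /expects q_lt; case: eqP.
apply: merges_step => b x' y' xb yb.
have bl : b = l.
  by case/orP: only => only; [exact: only_l only xb|exact: only_l only yb].
rewrite {b}bl in xb yb.
have [lt_x cases_x] := beta_step kl ok_x xb; have [lt_y cases_y] := beta_step kl ok_y yb.
have ok_x' := block_delta_ok ok_x xb; have ok_y' := block_delta_ok ok_y yb.
case: (boolP (reads_only l x' || reads_only l y')) => [only'|].
  by apply: IHn => //; lia.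
have tailN : (N j <= N j <= pend_length j true)%N by rewrite leqnn ltnW ?tail_pend_length.
rewrite negb_or => /andP[/negP nx /negP ny].
case: cases_x => [->|[->|//]]; case: cases_y => [->|[->|//]].
- exact: merges_free.
- exact: merges_free_pend.
- exact/merges_sym/merges_free_pend.
- exact: merges_refl.
Qed.

Lemma merges_ok x y : state_ok x -> state_ok y -> merges x y.
Proof.
have shape z : state_ok z -> (exists l, reads_only l z) \/ (exists o, z = Free o) \/
    exists j l q, (N j <= q <= pend_length j true)%N /\ z = pend j l true q.
  case: z => [o|j l t q] ok_z; first by right; left; exists o.
  case: (ltnP q (N j)) => q_lt; first by left; exists l; rewrite /= q_lt eqxx.
  right; right; exists j, l, q; move: ok_z => /= /andP[_]; case: t; last first.
    by rewrite /pend_length addn0; lia.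
  by move=> q_le; rewrite /pend ifN; [split=> //; lia|apply/eqP; lia].
move=> ok_x ok_y; case: (shape x ok_x) => [[l x_l]|shape_x].
  by apply: (@merges_reads_only l) => //; rewrite x_l.
case: (shape y ok_y) => [[l y_l]|shape_y].
  by apply: (@merges_reads_only l) => //; rewrite y_l orbT.
case: shape_x => [[o ->]|[j [l [q [q_le ->]]]]];
  case: shape_y => [[o' ->]|[j' [l' [q' [q'_le ->]]]]].
- exact: merges_free.
- exact: merges_free_pend.
- exact/merges_sym/merges_free_pend.
- exact: merges_tails.
Qed.

Lemma block_cycle_unique x y v : x \in block_states -> y \in block_states ->
  v != [::] -> run delta x v = Some x -> run delta y v = Some y -> x = y.
Proof. by rewrite !mem_block_states => ok_x ok_y; apply: merges_cycle; apply: merges_ok. Qed.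

(** * Paths of the automaton and factors of concatenations *)

Inductive block_word : seq Blk -> Prop :=
  | WordSingle b : (forall j, kind b <> Kbeta j) -> block_word [:: b]
  | WordBeta j v l : map kind v = map (Kchain j) (iota 1 (r j)) ->
      kind l = Kbeta j -> block_word (v ++ nseq (N j) l)
  | WordTail j l v : kind l = Kbeta j -> map kind v = map (tail_kind j) (iota 0 (r j)) ->
      block_word (nseq (N j) l ++ v).

Definition block_star (v : seq Blk) : Prop :=
  exists vs, {in vs, forall w, block_word w} /\ v = flatten vs.

Lemma block_star_nil : block_star [::].
Proof. by exists [::]. Qed.

Lemma block_star_cat v w : block_star v -> block_star w -> block_star (v ++ w).
Proof.
move=> [vs [vsP ->]] [ws [wsP ->]]; exists (vs ++ ws); rewrite flatten_cat; split=> // u.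
by rewrite mem_cat => /orP[/vsP|/wsP].
Qed.

Lemma block_star_word v : block_word v -> block_star v.
Proof.
by move=> vP; exists [:: v]; rewrite /= cats0; split=> // w; rewrite inE => /eqP->.
Qed.

Lemma block_star_single b : (forall j, kind b <> Kbeta j) -> block_star [:: b].
Proof. by move=> kb; apply/block_star_word/WordSingle. Qed.

Lemma block_star_chain j ks v : map kind v = map (Kchain j) ks -> block_star v.
Proof.
elim: v ks => [|b v IHv] [|k ks] //= => [_|[kb /IHv v_star]]; first exact: block_star_nil.
by apply: (@block_star_cat [:: b]) v_star; apply: block_star_single => j'; rewrite kb.
Qed.

Lemma run_chain o j k v : (0 < k)%N -> map kind v = map (Kchain j) (iota 1 k) ->
  run delta (Free o) v = Some (Free (Some (j, k))).
Proof.
case: k => // k _; elim: k v => [|k IHk] v.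
  case: v => [|b [|? ?]] //= -[kb].
  by rewrite /free_step kb.
have -> : map (Kchain j) (iota 1 k.+2) = rcons (map (Kchain j) (iota 1 k.+1)) (Kchain j k.+2).
  by rewrite -[k.+2]addn1 iotaD map_cat cats1 addn1.
case/lastP: v => [|v b]; first by move/(congr1 size); rewrite size_rcons.
rewrite map_rcons => /rcons_inj[/IHk kv kb].
by rewrite run_rcons kv /= /free_step kb eqxx orbT.
Qed.

Lemma run_betas j l t q : (0 < q <= N j)%N ->
  run delta (pend j l t q) (nseq (N j - q) l) = Some (pend j l t (N j)).
Proof.
have [n] := ubnP (N j - q); elim: n => [|n IHn] in q *; first by rewrite ltn0.
move=> le_n; case: (ltnP q (N j)) => [q_lt q_gt0|q_ge q_le]; last first.
  have qN : q = N j by apply/eqP; rewrite eqn_leq q_ge; case/andP: q_le => _ ->.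
  by rewrite qN subnn.
rewrite -subnSK //.
rewrite /= {1}/pend ifN; last by apply/eqP; move: (pend_length_ge j t); lia.
by rewrite /= /expects q_lt eqxx /= IHn //; lia.
Qed.

Lemma run_free_betas o j l : kind l = Kbeta j ->
  run delta (Free o) (nseq (N j) l) = Some (pend j l (o != Some (j, r j)) (N j)).
Proof.
move=> kl; case eN : (N j) (N_gt0 j) => [//|n] _ /=.
have := @run_betas j l (o != Some (j, r j)) 1; rewrite eN subn1 /=.
by rewrite /free_step kl => ->.
Qed.

Lemma run_free_nonbeta o v : (forall b j, b \in v -> kind b <> Kbeta j) ->
  exists o', run delta (Free o) v = Some (Free o').
Proof.
elim: v o => [|b v IHv] o vP /=; first by exists o.
have vP' b' j : b' \in v -> kind b' <> Kbeta j by move=> b'v; apply: vP; rewrite inE b'v orbT.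
have := vP b; rewrite mem_head /free_step; case: (kind b) => [|j|j|j k] nb.
- exact: IHv.
- exact: IHv.
- by have := nb j isT.
by case: ifP => _; apply: IHv.
Qed.

Lemma run_tail j l i v : (i <= r j)%N -> map kind v = map (tail_kind j) (iota i (r j - i)) ->
  run delta (pend j l true (N j + i)) v = Some (Free None).
Proof.
elim: v i => [|b v IHv] i i_le.
  case: (ltnP i (r j)) => [i_lt|i_ge _]; first by rewrite -(subnSK i_lt).
  by rewrite /= /pend /pend_length (_ : i = r j) ?eqxx //; lia.
case: (ltnP i (r j)) => [i_lt|i_ge]; last by rewrite (_ : r j - i = 0)%N //; lia.
rewrite -(subnSK i_lt) /= => -[kb kv]; rewrite {1}/pend /pend_length eqn_add2l ltn_eqF //=.
rewrite /expects ltnNge leq_addr /= addKn kb eqxx /= -addnS.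
exact: IHv.
Qed.

Lemma tail_kind_nonbeta j i j' : tail_kind j i <> Kbeta j'.
Proof. by rewrite /tail_kind; case: ifP. Qed.

Lemma kinds_nonbeta (ks : seq (block_kind m)) v :
  (forall k j, k \in ks -> k <> Kbeta j) -> map kind v = ks ->
  forall b j, b \in v -> kind b <> Kbeta j.
Proof. by move=> ksP kv b j bv; apply: ksP; rewrite -kv map_f. Qed.

Lemma run_block_word o w : block_word w -> exists o', run delta (Free o) w = Some (Free o').
Proof.
case=> [b kb|j v l kv kl|j l v kl kv].
- by apply: run_free_nonbeta => b' j; rewrite inE => /eqP->.
- rewrite run_cat (run_chain o _ kv) //; last exact: leq_trans (r_ge2 j).
  rewrite /= run_free_betas // eqxx /= /pend /pend_length addn0 eqxx.
  by exists None.
(* If a complete chain of [j] precedes, the betas close it and the tail is read as free blocks;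
   otherwise the tail is the pending one. *)
rewrite run_cat run_free_betas //=; case: eqP => _ /=.
  rewrite /pend /pend_length addn0 eqxx; apply: run_free_nonbeta.
  apply: kinds_nonbeta kv => k j' /mapP[i _ ->]; exact: tail_kind_nonbeta.
by exists None; have := @run_tail j l 0 v; rewrite addn0 subn0; apply.
Qed.

Lemma run_block_words o vs : {in vs, forall w, block_word w} ->
  exists o', run delta (Free o) (flatten vs) = Some (Free o').
Proof.
elim: vs o => [|v vs IHvs] o vsP /=; first by exists o.
have [|o' ov] := @run_block_word o v; first by apply: vsP; rewrite mem_head.
rewrite run_cat ov; apply: IHvs => w wvs; apply: vsP.
by rewrite inE wvs orbT.
Qed.

Hypothesis chain_realized : forall j k, (0 < k <= r j)%N -> exists b, kind b = Kchain j k.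
Hypothesis alphat_realized : forall j, exists b, kind b = Kalphat j.

(* What may have been read before reaching the state [x]. *)
Definition pend_history (j : 'I_m) (l : Blk) (t : bool) (q : nat) (v : seq Blk) : Prop :=
  kind l = Kbeta j /\ exists v1 v2, block_star v1 /\
  if t then v = v1 ++ nseq (minn q (N j)) l ++ v2 /\
            map kind v2 = map (tail_kind j) (iota 0 (q - N j))
  else v = v1 ++ v2 ++ nseq q l /\
       map kind v2 = map (Kchain j) (iota 1 (r j)).

Definition history (x : state) (v : seq Blk) : Prop :=
  match x with
  | Free None => block_star v
  | Free (Some (j, k)) => exists v1 v2, [/\ block_star v1, v = v1 ++ v2
                            & map kind v2 = map (Kchain j) (iota 1 k)]
  | Pending j l t q => pend_history j l t q v
  end.

Lemma history_free o v : history (Free o) v -> block_star v.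
Proof.
case: o => [[j k]|] //= [v1 [v2 [v1_star -> kv2]]].
exact: block_star_cat v1_star (block_star_chain kv2).
Qed.

Lemma pend_history_end j l t v :
  pend_history j l t (pend_length j t) v -> block_star v.
Proof.
rewrite /pend_history /pend_length => -[kl [v1 [v2 [v1_star]]]]; case: t => -[-> kv2].
  rewrite (minn_idPr _) ?leq_addr //; apply: block_star_cat => //.
  by apply: block_star_word; apply: WordTail => //; rewrite kv2 addKn.
rewrite addn0; apply: block_star_cat => //.
by apply: block_star_word; apply: WordBeta.
Qed.

Lemma pend_history_pend j l t q v : pend_history j l t q v -> history (pend j l t q) v.
Proof. by rewrite /pend; case: eqP => [->|_] //; exact: pend_history_end. Qed.

Lemma history_step x v b x' : state_ok x -> history x v -> delta x b = Some x' ->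
  history x' (rcons v b).
Proof.
case: x => [o|j l t q] ok_x xv.
  have v_star := history_free xv; case=> <-.
  rewrite /free_step -cats1; case kb : (kind b) => [|j|j|j k].
  - by apply: block_star_cat => //; apply: block_star_single => j; rewrite kb.
  - by apply: block_star_cat => //; apply: block_star_single => j'; rewrite kb.
  - apply: pend_history_pend; split=> //; case: eqP xv => [->|_ _] /=.
      by move=> [v1 [v2 [v1_star -> kv2]]]; exists v1, v2; rewrite catA.
    by exists v, [::]; rewrite (minn_idPl (N_gt0 j)) (eqP (N_gt0 j)).
  have := chain_range kb; case: eqP => [k1 _|k1 k_le].
    by exists v, [:: b]; split=> //=; rewrite kb k1.
  rewrite /=; case: eqP xv => [->|_ _]; last first.
    by apply: block_star_cat => //; apply: block_star_single => j'; rewrite kb.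
  move=> [v1 [v2 [v1_star -> kv2]]]; exists v1, (v2 ++ [:: b]); rewrite catA; split=> //.
  rewrite map_cat kv2 /= kb; have -> : k = (k.-1 + 1)%N by lia.
  by rewrite iotaD map_cat /= addn1.
move=> /pending_step[e ->]; apply: pend_history_pend.
case: xv => kl [v1 [v2 [v1_star vE]]]; split=> //.
move: e; rewrite /expects; case: ltnP => [q_lt /eqP ->|q_ge /andP[t_true /eqP kb]].
  exists v1, v2; split=> //; case: t {ok_x} vE => -[-> kv2].
    move: kv2; rewrite (eqP (ltnW q_lt)) /= => kv2; have -> : v2 = [::] by case: (v2) kv2.
    rewrite !cats0 -cats1 -catA -[[:: l]]/(nseq 1 l) -nseqD; split.
      by congr (_ ++ nseq _ _); rewrite (minn_idPl (ltnW q_lt)) (minn_idPl q_lt) addn1.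
    by rewrite (eqP q_lt).
  split=> //; rewrite -cats1 -!catA -[[:: l]]/(nseq 1 l) -nseqD.
  by rewrite addn1.
move: vE ok_x; rewrite t_true => -[-> kv2] ok_x.
exists v1, (rcons v2 b); split=> //; split.
  rewrite -!cats1 -!catA; congr (_ ++ nseq _ _ ++ _).
  by rewrite !(minn_idPr _) //; lia.
by rewrite map_rcons kv2 kb subSn // -addn1 iotaD map_cat /= cats1.
Qed.

Lemma history_run x v w y : state_ok x -> history x v -> run delta x w = Some y ->
  history y (v ++ w).
Proof.
elim: w x v => [|b w IHw] x v ok_x xv /=; first by case=> <-; rewrite cats0.
case xb : (delta x b) => [x'|] //= x'w; rewrite -cat_rcons.
exact: IHw (block_delta_ok ok_x xb) (history_step ok_x xv xb) x'w.
Qed.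

Lemma kinds_realized (ks : seq (block_kind m)) :
  (forall k, k \in ks -> exists b, kind b = k) -> exists v, map kind v = ks.
Proof.
elim: ks => [|k ks IHks] ksP; first by exists [::].
have [b kb] := ksP k (mem_head _ _); have [|v kv] := IHks.
  by move=> k' k'ks; apply: ksP; rewrite inE k'ks orbT.
by exists (b :: v); rewrite /= kb kv.
Qed.

Lemma chain_word_exists j i n : (i + n <= r j)%N ->
  exists v, map kind v = map (Kchain j) (iota i.+1 n).
Proof.
move=> le_r; apply: kinds_realized => k /mapP[i' +->]; rewrite mem_iota => i'_le.
by apply: chain_realized; lia.
Qed.

Lemma tail_word_exists j i n : (i + n <= r j)%N ->
  exists v, map kind v = map (tail_kind j) (iota i n).
Proof.
move=> le_r; apply: kinds_realized => k /mapP[i' +->]; rewrite mem_iota => i'_le.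
rewrite /tail_kind; case: eqP => _; first exact: alphat_realized.
by apply: chain_realized; lia.
Qed.

Lemma history_exists x : state_ok x -> exists v, history x v.
Proof.
case: x => [[[j k]|]|j l t q] /= ok_x.
- have [|v kv] := @chain_word_exists j 0 k; first by lia.
  by exists v, [::], v; split=> //; exact: block_star_nil.
- by exists [::]; exact: block_star_nil.
case/andP: ok_x => /eqP kl; rewrite /pend_length /pend_history; case: t => q_le.
  have [|v kv] := @tail_word_exists j 0 (q - N j); first by lia.
  exists (nseq (minn q (N j)) l ++ v); split=> //; exists [::], v.
  by split; first exact: block_star_nil.
have [|v kv] := @chain_word_exists j 0 (r j); first by [].
exists (v ++ nseq q l); split=> //; exists [::], v.
by split; first exact: block_star_nil.
Qed.

Lemma history_completion x v : state_ok x -> history x v ->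
  exists v', block_star (v ++ v').
Proof.
case: x => [o|j l t q] ok_x xv; first by exists [::]; rewrite cats0; exact: history_free xv.
case: xv => kl [v1 [v2 [v1_star]]]; move: ok_x => /= /andP[_]; rewrite /pend_length.
case: t => q_le [-> kv2].
  have [|v3 kv3] := @tail_word_exists j (q - N j) (r j - (q - N j)); first by lia.
  case: (leqP q (N j)) => q_N.
    have := kv2; rewrite (eqP q_N) => /(congr1 size); rewrite !size_map /= => /size0nil v2_nil.
    exists (nseq (N j - q) l ++ v3); rewrite v2_nil cats0 -catA.
    apply: block_star_cat => //; rewrite catA -nseqD subnKC //.
    by apply: block_star_word; apply: WordTail => //; rewrite kv3 (eqP q_N) subn0.
  exists v3; rewrite -!catA; apply: block_star_cat => //.
  apply: block_star_word; apply: WordTail => //.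
  rewrite map_cat kv2 kv3 -map_cat -[X in _ = map _ (iota _ X)](@subnKC (q - N j)) ?iotaD //.
  by lia.
exists (nseq (N j - q) l); rewrite -!catA; apply: block_star_cat => //.
rewrite -nseqD subnKC; last by lia.
by apply: block_star_word; apply: WordBeta.
Qed.

(** The starting state is given some possible past and the pending word some completion; both exist
    because every kind of block in a chain or a tail is realised. *)
Lemma run_history x v : state_ok x -> run delta x v ->
  exists u w, block_star (u ++ v ++ w).
Proof.
move=> ok_x; case xv : (run delta x v) => [y|] // _.
have [u xu] := history_exists ok_x; have yuv := history_run ok_x xu xv.
have ok_y : state_ok y.
  elim: v x ok_x xv {u xu yuv} => [|b v IHv] x ok_x /=; first by case=> <-.
  by case xb : (delta x b) => [x'|] //=; apply: IHv (block_delta_ok ok_x xb).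
have [w ws] := history_completion ok_y yuv.
by exists u, w; rewrite catA.
Qed.

(** * Ranks and values of the states *)

Variables (a : int) (cnt : 'I_m -> nat -> int) (nb : 'I_m -> int).
Hypothesis kind_sum : forall F : block_kind m -> int,
  \sum_b F (kind b) = a * F Kfree
    + \sum_j (cnt j 1%N * F (Kalphat j)
              + \sum_(1 <= k < (r j).+1) cnt j k * F (Kchain j k) + nb j * F (Kbeta j)).

(** As there are equally many [alpha_i] and [alphat_i], the same product counts completions of
    chains and of tails. *)
Definition chain_prod (j : 'I_m) (k : nat) : int := \prod_(k <= i < (r j).+1) cnt j i.

(** The uncancelled transitions of a chain lead to a longer chain or to a pending state of the same
    list, hence chains lie above pending states and longer chains below shorter ones. *)
Definition state_rank (x : state) : nat :=
  match x with
  | Free None => 0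
  | Free (Some (j, k)) => N j + r j + (r j - k)
  | Pending j _ _ q => N j + r j - q
  end.

Definition is_chain (x : state) : bool := if x is Free (Some _) then true else false.

(** A pending tail has as value its number of completions; [q - N j] is truncated to [0] while betas
    are read. A complete chain differs from the root in that each of the [nb j] betas leads to value
    [1] instead of [chain_prod j 1], and a shorter chain inherits this difference once for each way
    to complete it. *)
Definition state_value (x : state) : int :=
  match x with
  | Free None => 1
  | Free (Some (j, k)) => 1 + chain_prod j k.+1 * nb j * (1 - chain_prod j 1)
  | Pending j _ t q => if t then chain_prod j (q - N j).+1 else 1
  end.

Local Notation val_at x b := (oapp state_value 0 (delta x b)).

Lemma chain_prodS j k : (k <= r j)%N -> chain_prod j k = cnt j k * chain_prod j k.+1.
Proof. by move=> le_k; rewrite /chain_prod big_ltn. Qed.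

Lemma chain_prod_end j : chain_prod j (r j).+1 = 1.
Proof. by rewrite /chain_prod big_geq. Qed.

Lemma state_value_pend j l t q :
  state_value (pend j l t q) = if t then chain_prod j (q - N j).+1 else 1.
Proof.
rewrite /pend; case: eqP => [->|//]; case: t => //=.
by rewrite /pend_length addKn chain_prod_end.
Qed.

Lemma state_rank_pend j l t q : (state_rank (pend j l t q) <= N j + r j - q)%N.
Proof. by rewrite /pend; case: ifP. Qed.

Lemma state_rank_pend1 j l t k : (k <= r j)%N ->
  (state_rank (pend j l t 1) < state_rank (Free (Some (j, k))))%N.
Proof.
move=> le_k; apply: leq_ltn_trans (state_rank_pend _ _ _ _) _ => /=.
by have := N_gt0 j; lia.
Qed.

Lemma state_rank_step x b y : state_ok x -> x != root -> delta x b = Some y ->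
  ~~ (is_chain x && (delta root b == Some y)) -> (state_rank y < state_rank x)%N.
Proof.
case: x => [[[j k]|]|j l t q] ok_x nx; last first.
- move=> /pending_step[_ ->] _; apply: leq_ltn_trans (state_rank_pend _ _ _ _) _.
  by move: ok_x => /= /andP[_]; rewrite /pend_length; case: (t); lia.
- by rewrite eqxx in nx.
  case=> <-; have -> : (delta root b == Some (free_step (Some (j, k)) b))
    = (free_step None b == free_step (Some (j, k)) b) by [].
  rewrite /free_step; case kb : (kind b) => [|j'|j'|j' k']; rewrite ?eqxx //.
    case: (eqVneq (Some (j, k)) (Some (j', r j'))) => [[<- ->] _|]; last by rewrite eqxx.
    exact: state_rank_pend1.
  case: (k' =P 1%N) => [_|k'1]; first by rewrite eqxx.
  rewrite !orFb; change (None == Some (j', k'.-1)) with false.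
  case: (eqVneq (Some (j, k)) (Some (j', k'.-1))) => [[jj' ek] _|]; last by rewrite eqxx.
  by have := chain_range kb; rewrite -jj'; move: ok_x k'1 ek => /=; lia.
Qed.

Lemma state_rank_root_step x b y : state_ok x -> x != root -> is_chain x ->
  delta root b = Some y -> delta x b != Some y -> (state_rank y < state_rank x)%N.
Proof.
case: x => [[[j k]|]|] // ok_x _ _; case=> <-.
have -> : (delta (Free (Some (j, k))) b != Some (free_step None b))
    = (free_step (Some (j, k)) b != free_step None b) by [].
rewrite /free_step; case kb : (kind b) => [|j'|j'|j' k']; rewrite ?eqxx //.
  case: (eqVneq (Some (j, k)) (Some (j', r j'))) => [[<- ->] _|]; last by rewrite eqxx.
  exact: state_rank_pend1.
case: (k' =P 1%N) => [_|k'1]; first by rewrite eqxx.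
by move=> _ /=; have := N_gt0 j; lia.
Qed.

Lemma kind_count K C : \sum_b (if kind b == K then C else 0) =
  match K with
  | Kfree => a
  | Kalphat j => cnt j 1%N
  | Kbeta j => nb j
  | Kchain j k => if (0 < k <= r j)%N then cnt j k else 0
  end * C.
Proof.
rewrite (kind_sum (fun K' => if K' == K then C else 0)).
have single j (E : 'I_m -> int) : (forall j', j' != j -> E j' = 0) -> \sum_j' E j' = E j.
  by move=> E0; rewrite (bigD1 j) //= big1 ?addr0.
have neq K1 K2 : K1 <> K2 -> (K1 == K2 :> block_kind m) = false by move/eqP/negbTE.
case: K => [|j|j|j k].
- rewrite eqxx big1 ?addr0 // => j _; rewrite !(neq _ Kfree) //.
  rewrite big1 ?mulr0 ?addr0 // => k _; rewrite neq ?mulr0 //.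
- rewrite neq // mulr0 add0r (single j) => [|j' nj].
    rewrite eqxx neq // mulr0 addr0 big1 ?addr0 // => k _; rewrite neq ?mulr0 //.
  rewrite neq => [|[/eqP]]; last by rewrite (negbTE nj).
  by rewrite neq // !mulr0 add0r addr0 big1 // => k _; rewrite neq ?mulr0.
- rewrite neq // mulr0 add0r (single j) => [|j' nj].
    rewrite neq // eqxx mulr0 add0r big1 ?add0r // => k _; rewrite neq ?mulr0 //.
  rewrite neq // mulr0 add0r neq => [|[/eqP]]; last by rewrite (negbTE nj).
  by rewrite mulr0 addr0 big1 // => k _; rewrite neq ?mulr0.
rewrite neq // mulr0 add0r (single j) => [|j' nj].
  rewrite !neq // !mulr0 add0r addr0; case: ifP => [k_le|k_out]; last first.
    rewrite mul0r big_nat big1 // => k' k'_le; rewrite neq ?mulr0 // => -[ek].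
    by move: k_out; rewrite -ek; lia.
  rewrite (bigD1_seq k) ?mem_index_iota ?iota_uniq //= eqxx.
  by rewrite big1 ?addr0 // => k' nk; rewrite neq ?mulr0 // => -[ek]; rewrite ek eqxx in nk.
rewrite !neq // !mulr0 add0r addr0 big1 // => k' _; rewrite neq ?mulr0 // => -[/eqP].
by rewrite (negbTE nj).
Qed.

Lemma chain_value_step j k : state_ok (Free (Some (j, k))) ->
  state_value (Free (Some (j, k)))
  = \sum_b val_at (Free (Some (j, k))) b + (1 - \sum_b val_at root b).
Proof.
move=> /= /andP[k_gt0 k_le]; rewrite addrCA -sumrB; congr (_ + _).
set D := nb j * (1 - chain_prod j 1).
(* Compared with the root block by block, only prolonging blocks and, at [k = r j], the betas can
   contribute. *)
transitivity (\sum_b ((if kind b == Kchain j k.+1 then chain_prod j k.+2 * D else 0)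
   + (if kind b == Kbeta j then if k == r j then 1 - chain_prod j 1 else 0 else 0))).
  rewrite big_split /= !kind_count /=; case: (eqVneq k (r j)) => [->|nk].
    by rewrite ltnn mul0r add0r chain_prod_end mul1r.
  have k_lt : (k < r j)%N by rewrite ltn_neqAle nk.
  by rewrite k_lt mulr0 addr0 (chain_prodS k_lt) -!mulrA.
apply: eq_bigr => b _; rewrite /= /free_step.
have neq K1 K2 : K1 <> K2 -> (K1 == K2 :> block_kind m) = false by move/eqP/negbTE.
case kb : (kind b) => [|j'|j'|j' k'].
- by rewrite !neq // subrr addr0.
- by rewrite !neq // subrr addr0.
- rewrite neq // add0r !state_value_pend.
  have -> : (1 - N j' = 0)%N by apply/eqP; exact: N_gt0.
  case: (eqVneq (Kbeta j') (Kbeta j)) => [[->]|nj].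
    rewrite (_ : (Some (j, k) == Some (j, r j)) = (k == r j)) /=.
      by case: eqP => //= _; rewrite subrr.
    by apply/eqP/eqP => [[->]|->].
  rewrite ifT ?subrr //; apply/negP => /eqP[jj' _].
  by rewrite jj' eqxx in nj.
rewrite [Kchain j' k' == Kbeta j]neq // addr0.
case: (k' =P 1%N) => [k'1|k'1].
  by rewrite subrr neq // => -[_ ek]; rewrite ek in k'1; case: k'1 k_gt0 => ->.
rewrite !orFb; change (None == Some (j', k'.-1)) with false.
case: (eqVneq (Some (j, k)) (Some (j', k'.-1))) => [[jj' ek]|ne].
  have ek' : k' = k.+1 by have := chain_range kb; move: k'1; lia.
  by rewrite -jj' ek' eqxx /= /D -mulrA; ring.
by rewrite neq ?subrr // => -[jj' ek]; rewrite jj' ek eqxx in ne.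
Qed.

Lemma pending_value_step j l t q : state_ok (Pending j l t q) ->
  state_value (Pending j l t q) = \sum_b val_at (Pending j l t q) b.
Proof.
move=> /= /andP[/eqP kl q_le].
have valE b : val_at (Pending j l t q) b
    = if expects j l t q b then if t then chain_prod j (q.+1 - N j).+1 else 1 else 0.
  by rewrite /=; case: ifP => //= _; rewrite state_value_pend.
under eq_bigr => b _ do rewrite [oapp _ _ _]valE /expects.
case: (ltnP q (N j)) => q_N.
  rewrite (bigD1 l) //= eqxx big1 ?addr0; last by move=> b /negbTE->.
  by case: (t) => //; have -> : (q - N j = q.+1 - N j)%N by lia.
(* With a false flag the pending word ends at [N j], which excludes [N j <= q]. *)
move: q_le; rewrite /pend_length; case: (t) => q_le; last by exfalso; lia.
rewrite /= kind_count /tail_kind subSn //; case: eqP => [->|q0].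
  by rewrite chain_prodS // ltnW ?r_ge2.
have in_range : (0 < (q - N j).+1 <= r j)%N by lia.
by rewrite in_range chain_prodS.
Qed.

Lemma state_value_step x : state_ok x -> x != root -> state_value x
  = \sum_b val_at x b + (if is_chain x then 1 - \sum_b val_at root b else 0).
Proof.
case: x => [[[j k]|]|j l t q] ok_x nx; first exact: chain_value_step.
  by rewrite eqxx in nx.
by rewrite addr0; exact: pending_value_step.
Qed.

Lemma root_value_sum : \sum_b val_at root b
  = a + \sum_j (cnt j 1%N + (cnt j 1%N * (1 + chain_prod j 2 * nb j * (1 - chain_prod j 1))
                            + \sum_(2 <= k < (r j).+1) cnt j k) + nb j * chain_prod j 1).
Proof.
(* [F] is the value reached from the root by one block: only [alpha] and [beta] lead away from the
   root. *)
pose F (K : block_kind m) : int := match K with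
  | Kfree | Kalphat _ => 1
  | Kbeta j => chain_prod j 1
  | Kchain j k => if k == 1%N then state_value (Free (Some (j, k))) else 1
  end.
transitivity (\sum_b F (kind b)).
  apply: eq_bigr => b _; rewrite /= /free_step; case kb : (kind b) => [|j|j|j k] //=.
    by rewrite state_value_pend; have -> : (1 - N j = 0)%N by apply/eqP; exact: N_gt0.
  by rewrite orbF; case: ifP.
rewrite kind_sum mulr1; congr (_ + _); apply: eq_bigr => j _.
rewrite mulr1; congr (_ + _ + _).
have r_gt0 : (1 < (r j).+1)%N by rewrite ltnS ltnW ?r_ge2.
rewrite big_ltn //=; congr (_ + _).
by apply: eq_big_nat => k /andP[k_gt1 _]; rewrite gtn_eqF // mulr1.
Qed.

Variables (S : finType) (wd : Blk -> seq S).
Hypothesis wd_neq0 : forall b, wd b != [::].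
Hypothesis wd_disjoint : forall x b b', x \in wd b -> x \in wd b' -> b = b'.
Hypothesis wd_rot : forall b q, (0 < q < size (wd b))%N -> rot q (wd b) != wd b.

Variable L : seq (seq S).
Hypothesis L_words : forall w, w \in L <->
  exists v, block_word v /\ w = flatten (map wd v).

Lemma flatten_map_flatten vs :
  flatten (map wd (flatten vs)) = flatten [seq flatten (map wd v) | v <- vs].
Proof. by elim: vs => //= v vs IHvs; rewrite map_cat flatten_cat IHvs. Qed.

Lemma class_bowen_franks : exists (n : nat) (A : 'M[nat]_n),
  [/\ conjugate (renewal_system L) (edge_shift A),
      cyclic_zmod (bowen_franks_group A)
    & bowen_franks_det A = 1 - (a + \sum_j (cnt j 1%N
        + (cnt j 1%N * (1 + chain_prod j 2 * nb j * (1 - chain_prod j 1))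
           + \sum_(2 <= k < (r j).+1) cnt j k) + nb j * chain_prod j 1))].
Proof.
rewrite -root_value_sum.
apply: (@block_bowen_franks S Blk wd wd_neq0 wd_disjoint wd_rot _ block_states delta
  block_states_closed L _ _ block_cycle_unique root state_rank is_chain state_value) => //.
- move=> s sL; have [vs [vsP ->]] : exists vs : seq (seq Blk),
      {in vs, forall v, block_word v} /\ flatten s = flatten (map wd (flatten vs)).
    elim: s sL => [|w s IHs] sL; first by exists [::].
    have [v [v_word ->]] := (L_words w).1 (sL w (mem_head _ _)).
    have [|vs [vsP eq_s]] := IHs; first by move=> w' w's; apply: sL; rewrite inE w's orbT.
    exists (v :: vs); split; last by rewrite /= map_cat flatten_cat eq_s.
    by move=> v'; rewrite inE => /orP[/eqP->|/vsP].
  have [o' run_vs] := run_block_words None vsP.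
  by exists root, (flatten vs); rewrite mem_block_states run_vs.
- move=> x v; rewrite mem_block_states => ok_x xv.
  have [u [w [vs [vsP uvw]]]] := run_history ok_x xv.
  exists [seq flatten (map wd v) | v <- vs]; split.
    by move=> w' /mapP[v' v'vs ->]; apply/L_words; exists v'; split=> //; exact: vsP.
  rewrite -flatten_map_flatten -uvw !map_cat !flatten_cat.
  by apply/infixP; eexists; eexists.
- by rewrite mem_block_states.
- by move=> x b y; rewrite mem_block_states; exact: state_rank_step.
- by move=> x b y; rewrite mem_block_states; exact: state_rank_root_step.
- by move=> x; rewrite mem_block_states; exact: state_value_step.
Qed.

End ClassAutomaton.

(** * Primitive words and letter expansions *)

Section Words.

Variable T : eqType.
Implicit Types (u v w x y z : seq T).

Lemma flatten_nseqM i k z :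
  flatten (nseq k (flatten (nseq i z))) = flatten (nseq (k * i) z).
Proof. by elim: k => //= k ->; rewrite mulSn nseqD flatten_cat. Qed.

Lemma size_flatten_nseq k z : size (flatten (nseq k z)) = (k * size z)%N.
Proof. by rewrite size_flatten /shape map_nseq sumn_nseq mulnC. Qed.

(** Euclid's algorithm on the lengths: the shorter word is a prefix of the longer one, and removing
    it preserves commutation. *)
Lemma commuting_words x y : x ++ y = y ++ x ->
  exists z i j, x = flatten (nseq i z) /\ y = flatten (nseq j z).
Proof.
have [n] := ubnP (size x + size y); elim: n => [|n IHn] in x y *; first by rewrite ltn0.
move=> le_n; wlog le_xy : x y le_n / (size x <= size y)%N.
  move=> W; case: (leqP (size x) (size y)) => [|/ltnW] le; first exact: W.
  rewrite addnC in le_n; move=> /esym /(W _ _ le_n le)[z [i [j [-> ->]]]].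
  by exists z, j, i.
case: (eqVneq x [::]) => [->|xn0] xy; first by exists y, 0%N, 1%N; rewrite /= cats0.
have [d yE] : exists d, y = x ++ d.
  exists (drop (size x) y); have := congr1 (take (size x)) xy.
  rewrite take_size_cat // takel_cat // => xE.
  by rewrite -{1}(cat_take_drop (size x) y) -xE.
have x_gt0 : (0 < size x)%N by rewrite lt0n size_eq0.
have [||z [i [j [xz dz]]]] := IHn x d.
- by move: le_n; rewrite yE size_cat; lia.
- by move: xy; rewrite yE -catA => /eqP; rewrite eqseq_cat // eqxx => /eqP.
by exists z, i, (i + j)%N; rewrite nseqD flatten_cat -dz -xz.
Qed.

(** A rotation fixing [w] makes the two parts of [w] commute. *)
Lemma rot_proper_power w q : (0 < q < size w)%N -> rot q w = w -> proper_power w.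
Proof.
move=> q_lt rot_w; have [|z [i [j [wi wj]]]] := @commuting_words (take q w) (drop q w).
  by rewrite cat_take_drop -[LHS]rot_w.
exists z, (i + j)%N; split; last by rewrite nseqD flatten_cat -wi -wj cat_take_drop.
have := congr1 size wi; have := congr1 size wj.
rewrite !size_flatten_nseq size_drop size_takel; last by lia.
by case: i {wi} => [|i]; case: j {wj} => [|j]; lia.
Qed.

Lemma primitive_root w : w != [::] ->
  exists z k, [/\ (0 < k)%N, w = flatten (nseq k z) & ~ proper_power z].
Proof.
have [n] := ubnP (size w); elim: n => [|n IHn] in w *; first by rewrite ltn0.
move=> le_n wn0; case: (pselect (proper_power w)) => [[u [k [k_ge2 wE]]]|]; last first.
  by exists w, 1%N; rewrite /= cats0.
have w_gt0 : (0 < size w)%N by rewrite lt0n size_eq0.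
have size_w := congr1 size wE; rewrite size_flatten_nseq in size_w.
have u_gt0 : (0 < size u)%N by move: w_gt0; rewrite size_w muln_gt0 => /andP[].
have [||z [i [i_gt0 uE zP]]] := IHn u.
- by nia.
- by rewrite -size_eq0 -lt0n.
by exists z, (k * i)%N; rewrite muln_gt0 i_gt0 andbT wE uE flatten_nseqM; split=> //; lia.
Qed.

Lemma renewal_system_power k w : (0 < k)%N ->
  renewal_system [:: flatten (nseq k w)] = renewal_system [:: w].
Proof.
move=> k_gt0; apply/funext => x; apply/propext; split=> xL i l.
  have [s [sL xs]] := xL i l; have sE : s = nseq (size s) (flatten (nseq k w)).
    by apply/all_pred1P/allP => v /sL; rewrite inE.
  exists (nseq (size s * k) w); rewrite -flatten_nseqM -sE; split=> // v.
  by rewrite mem_nseq inE => /andP[].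
have [s [sL xs]] := xL i l; have sE : s = nseq (size s) w.
  by apply/all_pred1P/allP => v /sL; rewrite inE.
exists (nseq (size s) (flatten (nseq k w))); split.
  by move=> v; rewrite mem_nseq inE => /andP[].
apply: infix_trans xs _; rewrite flatten_nseqM {1}sE.
have -> : (size s * k = size s + size s * k.-1)%N by case: k k_gt0 => //= k; rewrite mulnS.
by rewrite nseqD flatten_cat; apply/infixP; exists [::]; eexists.
Qed.

Lemma eq_renewal_system (L L' : seq (seq T)) : L =i L' ->
  renewal_system L = renewal_system L'.
Proof.
move=> eqL; apply/funext => x; apply/propext; split=> xL i l.
  by have [s [sL xs]] := xL i l; exists s; split=> // w /sL; rewrite eqL.
by have [s [sL xs]] := xL i l; exists s; split=> // w /sL; rewrite eqL.
Qed.

End Words.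

(** The word may be a proper power, but its primitive root generates the same system; the latter is
    the case of no list in [B] and one free block. *)
Lemma single_word_bowen_franks (S : finType) (w : seq S) : w != [::] ->
  exists (n : nat) (A : 'M[nat]_n),
    [/\ conjugate (renewal_system [:: w]) (edge_shift A),
        cyclic_zmod (bowen_franks_group A)
      & bowen_franks_det A = 0].
Proof.
move=> wn0; have [z [k [k_gt0 wE zP]]] := primitive_root wn0.
rewrite wE renewal_system_power //.
have none (j : 'I_0) : False by case: j.
have zn0 : z != [::].
  by apply: contraNneq wn0 => z0; rewrite wE z0; elim: (k).
have [||||||||||n [A [conjA cycA detA]]] :=
  @class_bowen_franks 0 unit (fun=> 2) (fun=> 1%N) (fun=> Kfree) _ _ _ _ _
    1 (fun _ _ => 0) (fun=> 0) _ S (fun=> z) _ _ _ [:: z]; try by move=> j; case: (none j).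
- by [].
- by move=> F; rewrite big_ord0 addr0 mul1r (big_pred1 tt) // => -[].
- by [].
- by move=> x [] [].
- by move=> _ q q_lt; apply/eqP => /(rot_proper_power q_lt).
- move=> v; rewrite inE; split=> [/eqP->|[u [u_word ->]]].
    by exists [:: tt]; rewrite /= cats0; split=> //; apply: WordSingle => j; case: (none j).
  by case: u_word => [b _|j|j]; [rewrite /= cats0|case: (none j)|case: (none j)].
by exists n, A; rewrite detA big_ord0 addr0 subrr; split.
Qed.

(** * Replacing letters by words of length [p] *)

Section Expansion.

Variables (T S : eqType) (e : T -> nat -> S) (p : nat) (A : {pred T}).
Hypothesis p_gt0 : (0 < p)%N.
Hypothesis e_inj : forall x y s t, x \in A -> y \in A -> (1 <= s <= p)%N ->
  (1 <= t <= p)%N -> e x s = e y t -> x = y /\ s = t.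

Definition expand (w : seq T) : seq S :=
  flatten [seq [seq e x s | s <- iota 1 p] | x <- w].

Lemma expand_cat u v : expand (u ++ v) = expand u ++ expand v.
Proof. by rewrite /expand map_cat flatten_cat. Qed.

Lemma expand_flatten (ws : seq (seq T)) : expand (flatten ws) = flatten (map expand ws).
Proof. by elim: ws => //= w ws IHws; rewrite expand_cat IHws. Qed.

Lemma size_expand w : size (expand w) = (size w * p)%N.
Proof. by elim: w => //= x w IHw; rewrite size_cat size_map size_iota mulSn -IHw. Qed.

Lemma expand_neq0 w : w != [::] -> expand w != [::].
Proof. by rewrite -!size_eq0 size_expand muln_eq0 negb_or => ->; rewrite -lt0n. Qed.

Lemma mem_expand a w : a \in expand w ->
  exists x s, [/\ x \in w, (1 <= s <= p)%N & a = e x s].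
Proof.
case/flattenP => _ /mapP[x xw ->] /mapP[s]; rewrite mem_iota => s_le ->.
by exists x, s; split=> //; lia.
Qed.

Lemma expand_share a u v : {subset u <= A} -> {subset v <= A} ->
  a \in expand u -> a \in expand v -> exists2 x, x \in u & x \in v.
Proof.
move=> uA vA /mem_expand[x [s [xu s_le ->]]] /mem_expand[y [t [yv t_le exy]]].
have [xy _] := e_inj (uA x xu) (vA y yv) s_le t_le exy.
by exists x => //; rewrite xy.
Qed.

Lemma expand_cons x w :
  exists b, size b = p.-1 /\ expand (x :: w) = e x 1 :: b ++ expand w.
Proof.
rewrite /expand /=; case: p p_gt0 => // p' _ /=.
by eexists; split; last reflexivity; rewrite size_map size_iota.
Qed.

Lemma expand_inj u v : {subset u <= A} -> {subset v <= A} -> expand u = expand v -> u = v.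
Proof.
elim: u v => [|x u IHu] [|y v] // uA vA.
- by have [b [_ ->]] := expand_cons y v.
- by have [b [_ ->]] := expand_cons x u.
move=> /eqP; rewrite -[x :: u]cat1s -[y :: v]cat1s !expand_cat eqseq_cat ?size_expand //.
case/andP => /eqP exy /eqP euv; have [bx [_ ex]] := expand_cons x [::].
have [by_ [_ ey]] := expand_cons y [::]; move: exy; rewrite ex ey => -[exy _].
have [|||| -> _] := e_inj _ _ _ _ exy; rewrite ?p_gt0 //.
- by apply: uA; rewrite mem_head.
- by apply: vA; rewrite mem_head.
congr (_ :: _); apply: IHu => // z zin; [apply: uA|apply: vA];
  by rewrite inE zin orbT.
Qed.

(** The subscript of a new letter is its position modulo [p], so only rotations by multiples of [p]
    can fix an expansion, and these come from rotations of [w]. *)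
Lemma rot_expand w q : {subset w <= A} -> (0 < q < size (expand w))%N ->
  rot q (expand w) = expand w -> exists2 q', (0 < q' < size w)%N & rot q' w = w.
Proof.
move=> wA; rewrite size_expand => /andP[q_gt0 q_lt] rot_q.
have q'_lt : (q %/ p < size w)%N by rewrite ltn_divLR.
have q_eq := divn_eq q p; move: (q %/ p)%N q'_lt q_eq => q' q'_lt q_eq.
have size_take_q' : size (take q' w) = q' by apply: size_takel; exact: ltnW.
have drop_qE : drop q (expand w) = drop (q %% p) (expand (drop q' w)).
  rewrite {1}q_eq -{1}(cat_take_drop q' w) expand_cat addnC -drop_drop.
  by rewrite drop_size_cat // size_expand size_take_q'.
have q_mod : (q %% p = 0)%N.
  case dw : (drop q' w) => [|y v].
    by have := congr1 size dw; rewrite size_drop /=; lia.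
  case ew : w => [|x w']; first by rewrite ew in q'_lt.
  have yA : y \in A by apply: wA; apply: (@mem_drop q'); rewrite dw mem_head.
  have xA : x \in A by apply: wA; rewrite ew mem_head.
  have mod_lt : (q %% p < p)%N by rewrite ltn_mod.
  move: rot_q; rewrite /rot drop_qE dw {2}ew /expand /= -/(expand v).
  rewrite drop_cat size_map size_iota mod_lt -map_drop drop_iota.
  have : (0 < p - q %% p)%N by rewrite subn_gt0.
  case: (p - q %% p)%N => // n _.
  move: mod_lt; case: (p) p_gt0 e_inj => // p' _ e_inj' mod_lt /= [eyx _].
  have s_le : (1 <= 1 + q %% p'.+1 <= p'.+1)%N by lia.
  have [_ st] := e_inj' _ _ _ _ yA xA s_le (ltn0Sn _ : 1 <= 1 <= p'.+1)%N eyx.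
  by lia.
have qE : q = (q' * p)%N by rewrite {1}q_eq q_mod addn0.
exists q'; first by rewrite q'_lt andbT; move: q_gt0; rewrite qE muln_gt0 => /andP[].
apply: expand_inj => //; first by move=> x; rewrite mem_rot => /wA.
rewrite -[RHS]rot_q /rot drop_qE q_mod drop0 expand_cat; congr (_ ++ _).
rewrite -{2}(cat_take_drop q' w) expand_cat qE.
by rewrite take_size_cat // size_expand size_take_q'.
Qed.

End Expansion.

(** * Lists in the class [H] *)

HB.instance Definition _ := gen_eqMixin B_letter.

Definition chain_letter (k i s : nat) : B_letter :=
  if k == 1 then Alpha i s else Gamma k i s.

Definition chain_word (T : Type) (P : B_parameters) (lt : B_letter -> T) (k i : nat) : seq T :=
  [seq lt (chain_letter k i s) | s <- iota 1 (B_n P k)].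

Section ClassBlocks.

Variable P : B_parameters.

(** Ordinals start at [0] and the indices of the words at [1]; in the dependent pair, first
    component [0] stands for [alpha]. *)
Definition class_block : finType :=
  ('I_(B_c P 1) + {k : 'I_(B_r P) & 'I_(B_c P k.+1)} + 'I_(B_d P))%type.

Definition block_letters (b : class_block) : seq B_letter :=
  match b with
  | inl (inl i) => [seq Alphat i.+1 s | s <- iota 1 (B_n P 1)]
  | inl (inr ki) =>
      [seq chain_letter (tag ki).+1 (tagged ki).+1 s | s <- iota 1 (B_n P (tag ki).+1)]
  | inr l => [:: Beta l.+1]
  end.

Definition class_kind (m : nat) (j : 'I_m) (b : class_block) : block_kind m :=
  match b with
  | inl (inl _) => Kalphat j
  | inl (inr ki) => Kchain j (tag ki).+1
  | inr _ => Kbeta j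
  end.

Lemma block_letters_valid b x : x \in block_letters b -> B_valid P x.
Proof.
case: b => [[i|[k i]]|l] /=; last by rewrite inE => /eqP->; exact: ltn_ord.
  by case/mapP => s; rewrite mem_iota => s_le ->; move: (ltn_ord i) s_le => /=; lia.
case/mapP => s; rewrite mem_iota => s_le ->; rewrite /chain_letter.
move: s_le (ltn_ord i) (ltn_ord k) => /=; move: (nat_of_ord i) => {}i.
by case: (nat_of_ord k) => [|k0] /=; lia.
Qed.

Lemma block_letters_uniq b : uniq (block_letters b).
Proof.
case: b => [[i|[k i]]|l] //=; rewrite map_inj_uniq ?iota_uniq // => s s'.
  by case.
by rewrite /chain_letter; case: ifP => _ [].
Qed.

Lemma block_letters_disjoint x b b' :
  x \in block_letters b -> x \in block_letters b' -> b = b'.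
Proof.
have chainE k i s k' i' s' : chain_letter k i s = chain_letter k' i' s' ->
    k = k' /\ i = i'.
  by rewrite /chain_letter; case: eqP => [->|_]; case: eqP => [->|_] // [].
have chain_alphat k i s i' s' : chain_letter k i s <> Alphat i' s'.
  by rewrite /chain_letter; case: ifP.
have chain_beta k i s l : chain_letter k i s <> Beta l.
  by rewrite /chain_letter; case: ifP.
case: b => [[i|[k i]]|l] /=; case: b' => [[i'|[k' i']]|l'] /=.
- by case/mapP => s _ -> /mapP[s' _ [/val_inj->]].
- by case/mapP => s _ -> /mapP[s' _ /esym/chain_alphat].
- by case/mapP => s _ ->; rewrite inE => /eqP.
- by case/mapP => s _ -> /mapP[s' _ /chain_alphat].
- case/mapP => s _ -> /mapP[s' _ /chainE[[/val_inj kk']]]; subst k'.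
  by case=> /val_inj->.
- by case/mapP => s _ ->; rewrite inE => /eqP/chain_beta.
- by rewrite inE => /eqP-> /mapP[s' _].
- by rewrite inE => /eqP-> /mapP[s' _ /esym/chain_beta].
- by rewrite inE => /eqP->; rewrite inE => /eqP[/val_inj->].
Qed.

Hypothesis P_ok : B_admissible P.

Lemma block_letters_neq0 b : block_letters b != [::].
Proof.
have [r_ge2 n_gt0 _ _] := P_ok.
rewrite -size_eq0; case: b => [[i|[k i]]|l] //=; rewrite size_map size_iota -lt0n.
  by have [|] := n_gt0 1%N; first by rewrite /= (leq_trans _ r_ge2).
by have [|] := n_gt0 k.+1; first by rewrite /= ltn_ord.
Qed.

Lemma class_kind_sum (m : nat) (j : 'I_m) (F : block_kind m -> int) :
  \sum_(b : class_block) F (class_kind j b)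
  = (B_c P 1)%:Z * F (Kalphat j)
    + \sum_(1 <= k < (B_r P).+1) (B_c P k)%:Z * F (Kchain j k)
    + (B_d P)%:Z * F (Kbeta j).
Proof.
have const n (C : int) : \sum_(i < n) C = n%:Z * C.
  by rewrite sumr_const card_ord -mulr_natl natz.
rewrite big_sumType big_sumType /= !const; congr (_ + _ + _).
rewrite big_add1 big_mkord /=.
transitivity (\sum_(k < B_r P) \sum_(i < B_c P k.+1) F (Kchain j k.+1)).
  by rewrite sig_big_dep.
by apply: eq_bigr => k _; rewrite const.
Qed.

End ClassBlocks.

Section ClassH.

Variables (T : eqType) (S : finType) (m : nat) (P : 'I_m -> B_parameters).
Variables (lt : 'I_m -> B_letter -> T) (Wt Lt : seq (seq T)).
Hypothesis P_ok : forall j, B_admissible (P j).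
Hypothesis lt_inj : forall j, {in B_valid (P j) &, injective (lt j)}.
Hypothesis disjointB : forall j j', j != j' -> forall u v,
  B_word (P j) (lt j) u -> B_word (P j') (lt j') v -> ~~ share_letter u v.
Hypothesis Wt_uniq : uniq Wt.
Hypothesis Wt_neq0 : [::] \notin Wt.
Hypothesis disjointWt : {in Wt &, forall u v, u != v -> ~~ share_letter u v}.
Hypothesis disjointB_Wt : forall j u v, B_word (P j) (lt j) u -> v \in Wt ->
  ~~ share_letter u v.
Hypothesis LtE : forall w, w \in Lt <-> (exists j, B_word (P j) (lt j) w) \/ w \in Wt.

Let Blk : finType := ('I_(size Wt) + {j : 'I_m & class_block (P j)})%type.

Definition bword (b : Blk) : seq T :=
  match b with
  | inl i => nth [::] Wt i
  | inr jb => map (lt (tag jb)) (block_letters (tagged jb))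
  end.

Definition bkind (b : Blk) : block_kind m :=
  match b with
  | inl _ => Kfree
  | inr jb => class_kind (tag jb) (tagged jb)
  end.

Let r j := B_r (P j).
Let N j := B_N (P j).
Let c j k := B_c (P j) k.

Local Notation chain j := (chain_word (P j) (lt j)).

Lemma bkind_chain b j k : bkind b = Kchain j k -> (0 < k <= r j)%N /\
  exists i, (0 < i <= c j k)%N /\ bword b = chain j k i.
Proof.
case: b => // -[j0 [[i|[k0 i]]|l]] //= [<- <-] {j k}; split; first exact: ltn_ord.
by exists i.+1; rewrite -map_comp; split; first exact: ltn_ord.
Qed.

Lemma bkind_alphat b j : bkind b = Kalphat j ->
  exists i, (0 < i <= c j 1)%N /\ bword b = alphat_word (P j) (lt j) i.
Proof.
case: b => // -[j0 [[i|[k0 i]]|l]] //= [<-] {j}.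
by exists i.+1; rewrite -map_comp; split; first exact: ltn_ord.
Qed.

Lemma bkind_beta b j : bkind b = Kbeta j ->
  exists l, (0 < l <= B_d (P j))%N /\ bword b = [:: lt j (Beta l)].
Proof.
case: b => // -[j0 [[i|[k0 i]]|l]] //= [<-] {j}.
by exists l.+1; split; first exact: ltn_ord.
Qed.

Lemma chain_block j k i : (0 < k <= r j)%N -> (0 < i <= c j k)%N ->
  exists b, bkind b = Kchain j k /\ bword b = chain j k i.
Proof.
case: k => // k k_lt; case: i => // i i_lt.
pose b : class_block (P j) := inl (inr (Tagged (fun k : 'I_(B_r (P j)) => 'I_(B_c (P j) k.+1))
  (Ordinal (i_lt : (i < B_c (P j) (Ordinal (k_lt : (k < B_r (P j))%N)).+1)%N)))).
by exists (inr (Tagged (fun j => class_block (P j)) b)); rewrite /= -map_comp.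
Qed.

Lemma alphat_block j i : (0 < i <= c j 1)%N ->
  exists b, bkind b = Kalphat j /\ bword b = alphat_word (P j) (lt j) i.
Proof.
case: i => // i i_lt.
pose b : class_block (P j) := inl (inl (Ordinal (i_lt : (i < B_c (P j) 1)%N))).
by exists (inr (Tagged (fun j => class_block (P j)) b)); rewrite /= -map_comp.
Qed.

Lemma beta_block j l : (0 < l <= B_d (P j))%N ->
  exists b, bkind b = Kbeta j /\ bword b = [:: lt j (Beta l)].
Proof.
case: l => // l l_lt; pose b : class_block (P j) := inr (Ordinal (l_lt : (l < B_d (P j))%N)).
by exists (inr (Tagged (fun j => class_block (P j)) b)).
Qed.

Lemma chain_blocks j ks (i : nat -> nat) :
  (forall k, k \in ks -> (0 < k <= r j)%N /\ (0 < i k <= c j k)%N) ->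
  exists v, map bkind v = map (Kchain j) ks /\
            flatten (map bword v) = flatten [seq chain j k (i k) | k <- ks].
Proof.
elim: ks => [|k ks IHks] ksP; first by exists [::].
have [k_le i_le] := ksP k (mem_head _ _); have [b [kb wb]] := chain_block k_le i_le.
have [|v [kv wv]] := IHks; first by move=> k' k'ks; apply: ksP; rewrite inE k'ks orbT.
by exists (b :: v); rewrite /= kb wb kv wv.
Qed.

(** Because [ks] has no repetition, a single function [i] can record the indices found at the
    different places. *)
Lemma chain_blocks_inv j ks v : uniq ks -> map bkind v = map (Kchain j) ks ->
  exists i : nat -> nat, (forall k, k \in ks -> (0 < i k <= c j k)%N) /\
    flatten (map bword v) = flatten [seq chain j k (i k) | k <- ks].
Proof.
elim: ks v => [|k ks IHks] [|b v] //=; first by exists (fun=> 0%N).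
case/andP => k_ks uniq_ks [kb kv]; have [i [iP wv]] := IHks v uniq_ks kv.
have [_ [i0 [i0_le wb]]] := bkind_chain kb.
exists (fun k' => if k' == k then i0 else i k'); split.
  by move=> k'; rewrite inE; case: eqP => [->|_] //=; exact: iP.
rewrite eqxx wb wv; congr (_ ++ flatten _); apply/eq_in_map => k' k'ks.
by case: eqP => // kk'; rewrite -kk' k'ks in k_ks.
Qed.

Lemma r_ge2 j : (2 <= r j)%N.
Proof. by case: (P_ok j). Qed.

Lemma gamma_wordsE j i :
  gamma_words (P j) (lt j) i = flatten [seq chain j k (i k) | k <- iota 2 (r j).-1].
Proof.
congr flatten; apply/eq_in_map => k; rewrite mem_iota => /andP[k_ge2 _].
by rewrite /chain_word /gamma_word /chain_letter gtn_eqF.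
Qed.

Lemma alpha_gamma_wordsE j i :
  alpha_word (P j) (lt j) (i 1%N) ++ gamma_words (P j) (lt j) i
  = flatten [seq chain j k (i k) | k <- iota 1 (r j)].
Proof.
by rewrite gamma_wordsE; case: (r j) (r_ge2 j).
Qed.

Lemma tail_kinds j : map (tail_kind j) (iota 0 (r j))
  = Kalphat j :: map (Kchain j) (iota 2 (r j).-1).
Proof.
case: (r j) (r_ge2 j) => // n _ /=; congr (_ :: _).
rewrite (iotaDl 1 1) -map_comp; apply/eq_in_map => k.
by rewrite mem_iota /tail_kind; case: k.
Qed.

Lemma bword_betas j l v : bword l = [:: lt j (Beta v)] ->
  flatten (map bword (nseq (N j) l)) = beta_word (P j) (lt j) v.
Proof. by move=> wl; rewrite /beta_word -/(N j); elim: (N j) => //= n ->; rewrite wl. Qed.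

Lemma Lt_words u : u \in Lt <->
  exists v, block_word r N bkind v /\ u = flatten (map bword v).
Proof.
split=> [/LtE[[j]|u_Wt]|].
- have [_ cn_gt0 _ _] := P_ok j; have r_gt0 : (0 < r j)%N by exact: ltnW (r_ge2 j).
  case=> {u} [i i_le|i i_le|k i k_le i_le|i l iP l_le|i l iP l_le].
  + have [|b [kb wb]] := @chain_block j 1 i _ i_le; first by rewrite /= r_gt0.
    exists [:: b]; rewrite /= cats0 wb; split=> //.
    by apply: WordSingle => j'; rewrite kb.
  + have [b [kb wb]] := @alphat_block j i i_le.
    exists [:: b]; rewrite /= cats0 wb; split=> //.
    by apply: WordSingle => j'; rewrite kb.
  + have [|b [kb wb]] := @chain_block j k i _ i_le; first by move: k_le => /andP[/ltnW->].
    exists [:: b]; rewrite /= cats0 wb; split.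
      by apply: WordSingle => j'; rewrite kb.
    rewrite /chain_word /gamma_word /chain_letter gtn_eqF //.
    by case/andP: k_le.
  + have [b [kb wb]] := beta_block l_le.
    have [|v [kv wv]] := @chain_blocks j (iota 1 (r j)) i.
      by move=> k; rewrite mem_iota => k_le; split; [lia|apply: iP; rewrite -/(r j); lia].
    exists (v ++ nseq (N j) b); split; first exact: WordBeta.
    by rewrite map_cat flatten_cat (bword_betas wb) wv -alpha_gamma_wordsE catA.
  have [b [kb wb]] := beta_block l_le.
  have [|a [ka wa]] := @alphat_block j (i 1%N); first by apply: iP; rewrite /= r_gt0.
  have [|v [kv wv]] := @chain_blocks j (iota 2 (r j).-1) i.
    by move=> k; rewrite mem_iota => k_le; split; [lia|apply: iP; rewrite -/(r j); lia].
  exists (nseq (N j) b ++ a :: v); split; first by apply: WordTail; rewrite //= tail_kinds ka kv.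
  by rewrite map_cat flatten_cat /= (bword_betas wb) wa wv gamma_wordsE.
- pose b : Blk := inl (Ordinal (etrans (index_mem u Wt) u_Wt)).
  exists [:: b]; rewrite /= cats0 nth_index //; split=> //.
  exact: WordSingle.
case=> v [v_word ->]; apply/LtE; case: v_word => {v} [b kb|j v l kv kl|j l v kl kv].
- rewrite /= cats0; case kb' : (bkind b) => [|j|j|j k].
  + by right; case: b kb kb' => [i _ _|[j [[]|]]] //=; rewrite mem_nth.
  + have [i [i_le ->]] := bkind_alphat kb'.
    by left; exists j; apply: BAlphat.
  + by have := kb j.
  have [k_le [i [i_le ->]]] := bkind_chain kb'; left; exists j.
  case: (k =P 1%N) k_le i_le => [->|k1] k_le i_le; first exact: BAlpha.
  rewrite /chain_word /chain_letter; case: eqP => // _; apply: BGamma => //.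
  by rewrite -/(r j); lia.
- have [b [b_le wb]] := bkind_beta kl; left; exists j.
  have [i [iP wv]] := chain_blocks_inv (iota_uniq _ _) kv.
  have iP' : choice_of_indices (P j) i by move=> k k_le; apply: iP; rewrite mem_iota; exact: k_le.
  rewrite map_cat flatten_cat (bword_betas wb) wv -alpha_gamma_wordsE -catA.
  exact: BAlphaBeta.
have [b [b_le wb]] := bkind_beta kl; left; exists j.
case: v kv => [|a v]; rewrite tail_kinds //= => -[ka kv].
have [i0 [i0_le wa]] := bkind_alphat ka.
have [i [iP wv]] := chain_blocks_inv (iota_uniq _ _) kv.
(* The index of [alphat] is the value at [1] of the choice function, on which the [gamma] blocks
   impose nothing. *)
pose i' k := if k == 1%N then i0 else i k.
have iP' : choice_of_indices (P j) i'.
  move=> k k_le; rewrite /i'; case: eqP => [->//|k1]; apply: iP.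
  by rewrite mem_iota /r; lia.
rewrite map_cat flatten_cat (bword_betas wb) /= wa wv.
have -> : flatten [seq chain j k (i k) | k <- iota 2 (r j).-1] = gamma_words (P j) (lt j) i'.
  rewrite gamma_wordsE; congr flatten; apply/eq_in_map => k.
  by rewrite mem_iota /i' => /andP[k_ge2 _]; rewrite gtn_eqF.
by apply: (@BBetaAlphat _ _ _ i').
Qed.

Lemma nonbeta_Lt b : (forall j, bkind b <> Kbeta j) -> bword b \in Lt.
Proof.
move=> kb; apply/Lt_words; exists [:: b]; rewrite /= cats0; split=> //.
exact: WordSingle.
Qed.

(** Disjointness is assumed between words of the lists and is needed between blocks. A [beta_l] need
    not be a word by itself; it is found in the word whose other indices are all [1]. *)
Lemma bword_in_word j (b : class_block (P j)) : exists w,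
  B_word (P j) (lt j) w /\
  {subset bword (inr (Tagged (fun j => class_block (P j)) b)) <= w}.
Proof.
have [_ cn_gt0 _ N_gt0] := P_ok j.
pose b' : Blk := inr (Tagged (fun j => class_block (P j)) b).
rewrite -/b'; case kb : (bkind b') => [|j'|j'|j' k].
- by move: kb; rewrite /=; case: (b) => [[]|].
- have jj' : j = j' by move: kb; rewrite /=; case: (b) => [[]|] //= ? [].
  subst j'; have [i [i_le ->]] := bkind_alphat kb.
  by exists (alphat_word (P j) (lt j) i); split=> //; exact: BAlphat.
- have jj' : j = j' by move: kb; rewrite /=; case: (b) => [[]|] //= ? [].
  subst j'; have [l [l_le ->]] := bkind_beta kb.
  exists (alpha_word (P j) (lt j) 1 ++ gamma_words (P j) (lt j) (fun=> 1%N)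
          ++ beta_word (P j) (lt j) l); split.
    by apply: (@BAlphaBeta _ _ _ (fun=> 1%N)) => // k /cn_gt0[].
  move=> x; rewrite inE => /eqP->; rewrite !mem_cat /beta_word mem_nseq N_gt0 eqxx.
  by rewrite !orbT.
have jj' : j = j' by move: kb; rewrite /=; case: (b) => [[]|] //= ? [].
subst j'; have [k_le [i [i_le ->]]] := bkind_chain kb.
exists (chain j k i); split=> //.
case: (k =P 1%N) k_le i_le => [->|k1] k_le i_le; first exact: BAlpha.
rewrite /chain_word /chain_letter; case: eqP => // _; apply: BGamma => //.
by rewrite -/(r j); lia.
Qed.

Lemma bword_subset b : {subset bword b <= flatten Lt}.
Proof.
case: b => [i|[j b]] x xb.
  by apply/flattenP; exists (bword (inl i)) => //; apply: nonbeta_Lt.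
have [w [wP bw]] := bword_in_word b; apply/flattenP; exists w; last exact: bw.
by apply/LtE; left; exists j.
Qed.

Lemma not_share x (u v : seq T) : x \in u -> x \in v -> ~~ share_letter u v -> False.
Proof. by move=> xu xv /hasPn/(_ x xv); rewrite /= xu. Qed.

Lemma bword_disjoint x b b' : x \in bword b -> x \in bword b' -> b = b'.
Proof.
case: b b' => [i|[j b]] [i'|[j' b']] xb xb'.
- have [|ne] := eqVneq (nth [::] Wt i) (nth [::] Wt i').
    by move/eqP; rewrite nth_uniq // => /eqP/val_inj->.
  by case: (not_share xb xb'); apply: disjointWt; rewrite ?mem_nth.
- have [w [wP b'w]] := bword_in_word b'.
  by case: (not_share (b'w x xb') xb); apply: disjointB_Wt wP _; rewrite mem_nth.
- have [w [wP bw]] := bword_in_word b.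
  by case: (not_share (bw x xb) xb'); apply: disjointB_Wt wP _; rewrite mem_nth.
have [jj'|ne] := eqVneq j j'; last first.
  have [w [wP bw]] := bword_in_word b; have [w' [w'P b'w']] := bword_in_word b'.
  by case: (not_share (bw x xb) (b'w' x xb')); exact: disjointB ne _ _ wP w'P.
subst j'; move: xb xb' => /= /mapP[y yb ->] /mapP[y' yb'].
have vy := block_letters_valid yb; have vy' := block_letters_valid yb'.
move/(lt_inj vy vy') => yy'; rewrite -yy' in yb'.
by rewrite (block_letters_disjoint yb yb').
Qed.

Lemma bword_neq0 b : bword b != [::].
Proof.
case: b => [i|[j b]] /=.
  by apply: contraNneq Wt_neq0 => <-; rewrite mem_nth.
by rewrite -size_eq0 size_map size_eq0 block_letters_neq0.
Qed.

Lemma uniq_rot_neq (w : seq T) q : uniq w -> (0 < q < size w)%N -> rot q w <> w.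
Proof.
move=> uniq_w /andP[q_gt0 q_lt] rot_w; case ew : w => [|x w']; first by rewrite ew in q_lt.
have : nth x (rot q w) 0 = nth x w 0 by rewrite rot_w.
rewrite /rot nth_cat size_drop subn_gt0 q_lt nth_drop addn0 => /eqP.
rewrite nth_uniq //; last exact: leq_ltn_trans q_lt.
by move=> /eqP q0; rewrite q0 in q_gt0.
Qed.

(** A block of a list in [B] repeats no letter; primitivity is a condition on the extra words
    alone. *)
Lemma bword_rot b q : (forall w, w \in Wt -> ~ proper_power w) ->
  (0 < q < size (bword b))%N -> rot q (bword b) <> bword b.
Proof.
case: b => [i|[j b]] WtP q_lt /=.
  by move=> /(rot_proper_power q_lt); apply: WtP; rewrite mem_nth.
apply: uniq_rot_neq => //; rewrite map_inj_in_uniq ?block_letters_uniq // => x y xb yb.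
by apply: lt_inj; [exact: block_letters_valid xb|exact: block_letters_valid yb].
Qed.

Lemma bkind_sum (F : block_kind m -> int) :
  \sum_b F (bkind b) = (size Wt)%:Z * F Kfree
    + \sum_j ((c j 1)%:Z * F (Kalphat j)
              + \sum_(1 <= k < (r j).+1) (c j k)%:Z * F (Kchain j k)
              + (B_d (P j))%:Z * F (Kbeta j)).
Proof.
rewrite big_sumType /= sumr_const card_ord -mulr_natl natz; congr (_ + _).
transitivity (\sum_j \sum_(b : class_block (P j)) F (class_kind j b)).
  by rewrite sig_big_dep.
by apply: eq_bigr => j _; rewrite class_kind_sum.
Qed.

Variables (p : nat) (e : T -> nat -> S) (L : seq (seq S)).
Hypothesis p_gt0 : (0 < p)%N.
Hypothesis e_inj : forall x y s t, x \in flatten Lt -> y \in flatten Lt ->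
  (1 <= s <= p)%N -> (1 <= t <= p)%N -> e x s = e y t -> x = y /\ s = t.
Hypothesis LE : L =i map (expand e p) Lt.

Definition xword (b : Blk) : seq S := expand e p (bword b).

Lemma xword_neq0 b : xword b != [::].
Proof. exact/expand_neq0/bword_neq0. Qed.

Lemma xword_disjoint a b b' : a \in xword b -> a \in xword b' -> b = b'.
Proof.
move=> ab ab'.
have [x xb xb'] := expand_share e_inj (@bword_subset b) (@bword_subset b') ab ab'.
exact: bword_disjoint xb xb'.
Qed.

Lemma L_words w : w \in L <->
  exists v, block_word r N bkind v /\ w = flatten (map xword v).
Proof.
have flatE v : flatten (map xword v) = expand e p (flatten (map bword v)).
  by rewrite expand_flatten -map_comp.
rewrite LE; split=> [/mapP[u /Lt_words[v [v_word ->]] ->]|[v [v_word ->]]].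
  by exists v; rewrite flatE.
by rewrite flatE; apply: map_f; apply/Lt_words; exists v.
Qed.

Lemma classH_bowen_franks : extra_words_primitive Wt L ->
  exists (n : nat) (A : 'M[nat]_n),
    [/\ conjugate (renewal_system L) (edge_shift A),
        cyclic_zmod (bowen_franks_group A)
      & bowen_franks_det A =
        1 - H_gamma P (size Wt)
        + \sum_(j < m) (B_gamma (P j) (B_r (P j)) * B_t (P j) - B_b (P j))].
Proof.
have chain_in b j k : bkind b = Kchain j k -> (0 < k <= r j)%N by case/bkind_chain.
have chain_ex j k : (0 < k <= r j)%N -> exists b, bkind b = Kchain j k.
  move=> k_le; have [|b [kb _]] := @chain_block j k 1 k_le; last by exists b.
  by have [_ /(_ k k_le)[_ ->]] := P_ok j.
have alphat_ex j : exists b, bkind b = Kalphat j.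
  have [|b [kb _]] := @alphat_block j 1; last by exists b.
  by have [r2 /(_ 1%N)[|_ ->]] := P_ok j; rewrite //= (leq_trans _ r2).
(* If [L] has one word, all blocks other than betas coincide. An [alpha] and an [alphat] of one list
   being distinct, there is no list and exactly one extra word, and the formula gives [1 - 1]. *)
case=> [[w Lw]|WtP].
  have wordE b : (forall j, bkind b <> Kbeta j) -> xword b = w.
    move=> kb; apply/eqP; move: (Lw (xword b)); rewrite inE => <-.
    by rewrite LE; apply/map_f/nonbeta_Lt.
  have nonbeta_eq b b' : (forall j, bkind b <> Kbeta j) ->
      (forall j, bkind b' <> Kbeta j) -> b = b'.
    move=> kb kb'; have := xword_neq0 b; case xb : (xword b) => [//|a u] _.
    apply: (@xword_disjoint a); first by rewrite xb mem_head.
    by rewrite (wordE b' kb') -(wordE b kb) xb mem_head.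
  have no_j (j : 'I_m) : False.
    have [b kb] := alphat_ex j; have [|b' kb'] := chain_ex j 1%N.
      by rewrite /= ltnW ?r_ge2.
    have eq_b : b = b' by apply: nonbeta_eq => j'; rewrite ?kb ?kb'.
    by move: kb'; rewrite -eq_b kb.
  have w_in : w \in L by rewrite Lw mem_head.
  have wn0 : w != [::].
    have [v [v_word wE]] := (L_words w).1 w_in.
    case: v_word wE => [b _ ->|j|j]; [by rewrite /= cats0 xword_neq0|by case: (no_j j)..].
  have size_Wt : size Wt = 1%N.
    have [v [v_word _]] := (L_words w).1 w_in.
    case: v_word => [[i _|[j]]|j|j]; [|by case: (no_j j)..].
    have lt_i := ltn_ord i; case: (ltnP 1 (size Wt)) => [lt1|]; last by lia.
    have eq01 : inl (Ordinal (ltnW lt1)) = inl (Ordinal lt1) :> Blk by apply: nonbeta_eq.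
    by have := congr1 (fun b : Blk => if b is inl i then val i else 0%N) eq01.
  have [n [A [conjA cycA detA]]] := single_word_bowen_franks wn0.
  exists n, A; rewrite (eq_renewal_system Lw) detA /H_gamma size_Wt.
  by rewrite !big1 ?addr0 ?subrr // => j _; case: (no_j j).
have xword_rot b q : (0 < q < size (xword b))%N -> rot q (xword b) != xword b.
  move=> q_lt; apply/eqP => rot_b.
  have [q' q'_lt] := rot_expand p_gt0 e_inj (@bword_subset b) q_lt rot_b.
  exact: bword_rot q'_lt.
have N_gt0 j : (0 < N j)%N by case: (P_ok j).
have [n [A [conjA cycA detA]]] :=
  class_bowen_franks r_ge2 N_gt0 chain_in chain_ex alphat_ex bkind_sum
    xword_neq0 xword_disjoint xword_rot L_words.
exists n, A; split=> //; rewrite detA /H_gamma -addrA; congr (_ + _).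
rewrite !opprD -addrA; congr (_ + _).
rewrite -!sumrN -big_split; apply: eq_bigr => j _ /=.
rewrite /B_t /B_b /B_alpha /B_alphat /B_beta /B_gamma /chain_prod.
have r2 := r_ge2 j; rewrite -/(r j).
rewrite [\prod_(1 <= _ < _) _]big_ltn; last by rewrite ltnS ltnW.
(* Separating [c_r] leaves the products up to [r - 1] of [B_t]; the last term of the sum accounts
   for the [- 1] in [B_t]. *)
rewrite !(@big_nat_recr _ _ _ (r j) 2) //=.
set M := \prod_(2 <= _ < _) _; set s := \sum_(2 <= _ < _) _.
rewrite /c; ring.
Qed.

End ClassH.

Theorem theorem5p48 (T S : finType) (m : nat) (P : 'I_m -> B_parameters)
    (Wt : seq (seq T)) (L : seq (seq S))
    (hL : in_H P Wt L) (hWt : extra_words_primitive Wt L) :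
  exists (n : nat) (A : 'M[nat]_n),
    [/\ conjugate (renewal_system L) (edge_shift A),
        cyclic_zmod (bowen_franks_group A)
      & bowen_franks_det A =
        1 - H_gamma P (size Wt)
        + \sum_(j < m) (B_gamma (P j) (B_r (P j)) * B_t (P j) - B_b (P j))].
Proof.
have [Lt [p [[W [WB disjW Wt_ok [disjWt disjW_Wt] LtE]] p_gt0 [e [e_inj LE]]]]] := hL.
have /andP[Wt_uniq Wt_nil] := Wt_ok.
have /fin_all_exists[lt ltP] : forall j, exists lt : B_letter -> T,
    {in B_valid (P j) &, injective lt} /\ (forall w, w \in W j <-> B_word (P j) lt w).
  by move=> j; have [_ [lt ltP]] := WB j; exists lt.
have inW j w : B_word (P j) (lt j) w -> w \in W j by move=> /(ltP j).2.
apply: (@classH_bowen_franks T S m P lt Wt Lt _ _ _ Wt_uniq Wt_nil disjWt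
          _ _ p e L p_gt0 e_inj LE hWt).
- by move=> j; case: (WB j).
- by move=> j; case: (ltP j).
- by move=> j j' ne u v /inW uW /inW vW; exact: disjW ne _ _ uW vW.
- by move=> j u v /inW uW; exact: disjW_Wt uW.
move=> w; split=> [/LtE[[j wj]|wWt]|[[j wj]|wWt]].
- by left; exists j; apply/(ltP j).2.
- by right.
- by apply/LtE; left; exists j; exact: inW.
- by apply/LtE; right.
Qed.
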